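(* The ultimate periodicity problem for HD0L systems is decidable. That is, there is an algorithm which, given finite alphabets $A$ and $B$, a morphism $\varphi\colon A^*\to A^*$, a morphism $h\colon A^*\to B^*$ and a letter $a_1\in A$ such that $\varphi$ extends over $a_1$ and $h(\varphi^{\infty}(a_1))$ is an infinite word, decides whether the infinite word $h(\varphi^{\infty}(a_1))$ is ultimately periodic.
   Context: A morphism $\varphi\colon A^*\to A^*$ (a substitution) extends over the letter $a_1$ if $\varphi(a_1)=a_1v$ for some word $v$ with $\varphi^k(v)\neq\varepsilon$ for all $k\in\mathbb N$; then $\varphi^{\infty}(a_1)=a_1v\varphi(v)\varphi^2(v)\cdots$ is an infinite word (the fixed point of $\varphi$ starting with $a_1$). Morphisms are extended to infinite words letterwise. An infinite word $W$ is periodic if $W=uuu\cdots$ for a nonempty finite word $u$, and ultimately periodic if $W=wW'$ with $w$ finite and $W'$ periodic. *)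

(* Defs.v *)
From mathcomp Require Import all_boot.
Set Implicit Arguments. Unset Strict Implicit. Unset Printing Implicit Defensive.

Definition morph (A B : Type) (f : A -> seq B) (s : seq A) : seq B :=
  flatten (map f s).

Definition extends_over (n : nat) (phi : 'I_n -> seq 'I_n) (a1 : 'I_n) : Prop :=
  exists v : seq 'I_n, phi a1 = a1 :: v /\
    forall k : nat, iter k (morph phi) v <> [::].

(* phi^infty(a1) as an infinite word (nat -> letter): its i-th letter is the
   i-th letter of phi^i(a1), which has length >= i+1 when phi extends over a1
   (phi^i(a1) = a1 v phi(v) ... phi^(i-1)(v) is a prefix of phi^infty(a1)). *)
Definition fixpoint (n : nat) (phi : 'I_n -> seq 'I_n) (a1 : 'I_n) : nat -> 'I_n :=
  fun i => nth a1 (iter i (morph phi) [:: a1]) i.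

Definition is_image (A B : Type) (h : A -> seq B) (W : nat -> A) (U : nat -> B) : Prop :=
  forall k : nat, mkseq U (size (morph h (mkseq W k))) = morph h (mkseq W k).

Definition infinite_image (A B : Type) (h : A -> seq B) (W : nat -> A) : Prop :=
  forall N : nat, exists k : nat, N < size (morph h (mkseq W k)).

Definition ultimately_periodic (B : Type) (U : nat -> B) : Prop :=
  exists p N : nat, 0 < p /\ forall i : nat, N <= i -> U (i + p) = U i.

Definition image_ultimately_periodic (A B : Type) (h : A -> seq B) (W : nat -> A) : Prop :=
  exists U : nat -> B, is_image h W U /\ ultimately_periodic U.

Inductive code : Type :=
| CZero : code
| CSucc : code
| CProj : nat -> code
| CComp : code -> list code -> code
| CPrimRec : code -> code -> code
| CMu : code -> code.

(* Big-step semantics: eval c args r  <->  program c on arguments args halts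
   with result r.  (Arity is not tracked; projections default to 0.) *)
Inductive eval : code -> seq nat -> nat -> Prop :=
| ev_zero v : eval CZero v 0
| ev_succ v : eval CSucc v (head 0 v).+1
| ev_proj i v : eval (CProj i) v (nth 0 v i)
| ev_comp f gs v ys r : evals gs v ys -> eval f ys r -> eval (CComp f gs) v r
| ev_prim0 f g w r : eval f w r -> eval (CPrimRec f g) (0 :: w) r
| ev_primS f g k w r y :
    eval (CPrimRec f g) (k :: w) r -> eval g (k :: r :: w) y ->
    eval (CPrimRec f g) (k.+1 :: w) y
| ev_mu f v n :
    eval f (n :: v) 0 ->
    (forall m, m < n -> exists k, eval f (m :: v) k.+1) ->
    eval (CMu f) v n
with evals : list code -> seq nat -> seq nat -> Prop :=
| evs_nil v : evals [::] v [::]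
| evs_cons g gs v y ys : eval g v y -> evals gs v ys -> evals (g :: gs) v (y :: ys).

Definition cantor_pair (x y : nat) : nat := (x + y) * (x + y).+1 %/ 2 + y.

Fixpoint code_list (l : seq nat) : nat :=
  if l is x :: l' then (cantor_pair x (code_list l')).+1 else 0.

Definition encode_word (k : nat) (s : seq 'I_k) : nat := code_list (map val s).

Definition encode_morph (n k : nat) (f : 'I_n -> seq 'I_k) : nat :=
  code_list [seq encode_word (f i) | i <- enum 'I_n].

Definition encode_input (n m : nat) (phi : 'I_n -> seq 'I_n) (h : 'I_n -> seq 'I_m)
  (a1 : 'I_n) : nat :=
  code_list [:: n; m; val a1; encode_morph phi; encode_morph h].

(* Main.v *)
(* All words h(phi^k(a1)) are prefixes of the infinite word U in question,
   so a program can compute arbitrarily long prefixes of U; it suffices to bound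
   the data it has to look at by a primitive recursive function of the input.

   For a fixed p, reading U through a buffer of its last p letters is a finite
   deterministic process when followed along k: the action of h(phi^k(b)) on
   buffers, for all letters b at once, determines the action of h(phi^(k+1)(b)).
   Hence U has eventual period p iff no mismatch occurs between the prefixes
   h(phi^K(a1)) and h(phi^(2K)(a1)), for an explicit K.

   It remains to bound the least eventual period p of an ultimately periodic U.
   Replace phi by a power psi whose relation "c occurs in psi(b)" is idempotent,
   and remove the letters that eventually contribute nothing. If only
   nongrowing letters keep occurring, U is visibly periodic. Otherwise choose a
   minimal class C of growing letters, on which the occurrence relation is total.
   Either some letter of C accumulates longer and longer runs of nongrowing
   letters, which carry powers of a short word, so that p is small; or such runs are
   bounded, and then the words psi^t(d), d in C, are uniformly recurrent and the
   images of C at each level k have comparable lengths, about lam_k.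
   In this case let z_k be the level-k image of a fixed long factor of psi^t(d).
   As long as lam_k <= p, successive occurrences of z_k in U are at distance
   between lam_k and a constant times lam_k, and the pattern of equalities between the
   contents of U following these occurrences is determined by a datum ranging
   over a finite set independent of k. If two levels i < j, with lam_j much
   larger than lam_i, had the same datum, the number q of occurrences of z_j per period
   would satisfy q lam_j <= p <= q const lam_i, which is absurd. So there are
   boundedly many levels with lam_k <= p, which bounds p. *)
From Stdlib Require Import Classical.
Require Import Defs.
From mathcomp Require Import all_boot zify.
Set Implicit Arguments. Unset Strict Implicit. Unset Printing Implicit Defensive.

(** * Morphisms of free monoids *)

Section Morph.
Variables A B : Type.
Implicit Types (f : A -> seq B) (s t : seq A).

Lemma morph_cat f s t : morph f (s ++ t) = morph f s ++ morph f t.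
Proof. by rewrite /morph map_cat flatten_cat. Qed.

Lemma morph_cons f b s : morph f (b :: s) = f b ++ morph f s.
Proof. by []. Qed.

Lemma morph1 f b : morph f [:: b] = f b.
Proof. by rewrite /morph /= cats0. Qed.

End Morph.

Section Morph2.
Variables A B D : Type.
Implicit Types (f : A -> seq B) (s t : seq A).

Lemma morph_comp (k : B -> seq D) f s : morph k (morph f s) = morph (fun b => morph k (f b)) s.
Proof. by elim: s => //= b s IH; rewrite !morph_cons morph_cat IH. Qed.

Lemma eq_morph f1 f2 : f1 =1 f2 -> morph f1 =1 morph f2.
Proof. by move=> E s; rewrite /morph (eq_map E). Qed.

Lemma size_morph_le f s c : (forall b, size (f b) <= c) -> size (morph f s) <= size s * c.
Proof.
move=> H; elim: s => //= b s IH.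
by rewrite morph_cons size_cat mulSn leq_add.
Qed.

Lemma size_morph_ge f s : (forall b, 0 < size (f b)) -> size s <= size (morph f s).
Proof.
move=> H; elim: s => //= b s IH.
by rewrite morph_cons size_cat -add1n leq_add.
Qed.

Lemma size_morph_take_le f s i j : i <= j -> size (morph f (take i s)) <= size (morph f (take j s)).
Proof.
move=> ij; rewrite -(cat_take_drop i (take j s)) morph_cat size_cat.
by rewrite take_takel // leq_addr.
Qed.

Lemma drop_morph f s i : drop (size (morph f (take i s))) (morph f s) = morph f (drop i s).
Proof. by rewrite -{2}(cat_take_drop i s) morph_cat drop_size_cat. Qed.

Lemma morph_locate f s x : x < size (morph f s) ->
  exists2 i, i < size s & size (morph f (take i s)) <= x < size (morph f (take i.+1 s)).
Proof.
elim: s x => [|b s IH] x //=; rewrite morph_cons size_cat => H.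
case: (ltnP x (size (f b))) => Hx.
  by exists 0 => //=; rewrite take0 morph1.
have /IH [i Hi /andP[H1 H2]] : x - size (f b) < size (morph f s).
  by rewrite ltn_subLR.
exists i.+1 => //=; rewrite !morph_cons !size_cat.
by rewrite -leq_subRL // H1 -ltn_subLR.
Qed.

End Morph2.

Lemma mem_morphP (A B : eqType) (f : A -> seq B) s c :
  reflect (exists2 b, b \in s & c \in f b) (c \in morph f s).
Proof. exact: flatten_mapP. Qed.

Lemma eq_in_morph (A : eqType) (B : Type) (f1 f2 : A -> seq B) s :
  {in s, f1 =1 f2} -> morph f1 s = morph f2 s.
Proof. by move=> E; rewrite /morph; congr flatten; apply/eq_in_map. Qed.

Lemma size_morph_le_in (A : eqType) (B : Type) (f : A -> seq B) s c :
  {in s, forall b, size (f b) <= c} -> size (morph f s) <= size s * c.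
Proof.
elim: s => //= b s IH H.
rewrite morph_cons size_cat mulSn leq_add //; first by apply: H; rewrite mem_head.
by apply: IH => d Hd; apply: H; rewrite in_cons Hd orbT.
Qed.

Lemma size_morph_mem (A : eqType) (B : Type) (f : A -> seq B) s b :
  b \in s -> size (f b) <= size (morph f s).
Proof.
elim: s => //= c s IH; rewrite in_cons morph_cons size_cat => /orP[/eqP->|/IH H].
  exact: leq_addr.
exact: leq_trans H (leq_addl _ _).
Qed.

Lemma infix_morph (A B : eqType) (f : A -> seq B) s t :
  infix s t -> infix (morph f s) (morph f t).
Proof.
case/infixP=> [u [v ->]]; apply/infixP; exists (morph f u), (morph f v).
by rewrite !morph_cat.
Qed.

Definition pw (A : Type) (f : A -> seq A) (k : nat) (b : A) : seq A :=
  iter k (morph f) [:: b].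

Section Pw.
Variables (A : Type) (f : A -> seq A).

Lemma iter_morph k s : iter k (morph f) s = morph (pw f k) s.
Proof.
elim: k s => [|k IH] s.
  by elim: s => //= b s IH; rewrite morph_cons -IH.
by rewrite iterS IH morph_comp; apply: eq_morph => b; rewrite /pw iterS.
Qed.

Lemma pwS k b : pw f k.+1 b = morph f (pw f k b).
Proof. by []. Qed.

Lemma pwSr k b : pw f k.+1 b = morph (pw f k) (f b).
Proof. by rewrite /pw iterSr morph1 iter_morph. Qed.

Lemma pwD j k b : pw f (j + k) b = morph (pw f j) (pw f k b).
Proof. by rewrite /pw iterD iter_morph. Qed.

Lemma pw1 b : pw f 1 b = f b.
Proof. by rewrite /pw /= morph1. Qed.

Lemma pw0 b : pw f 0 b = [:: b].
Proof. by []. Qed.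

Lemma size_pw_le c k b : (forall b, size (f b) <= c) -> size (pw f k b) <= c ^ k.
Proof.
move=> H; elim: k b => [|k IH] b //.
rewrite pwS (leq_trans (size_morph_le _ H)) // expnSr leq_mul2r.
by rewrite IH orbT.
Qed.
End Pw.

Lemma pwM (A : Type) (f : A -> seq A) j k b : pw f (j * k) b = pw (pw f k) j b.
Proof.
by elim: j => [|j IH] //; rewrite mulSn pwD IH pwS.
Qed.

Lemma infix_nth (T : eqType) (x0 : T) (s t : seq T) :
  infix s t -> exists2 i, i + size s <= size t & forall j, j < size s -> nth x0 s j = nth x0 t (i + j).
Proof.
case/infixP=> [u [v ->]]; exists (size u).
  by rewrite !size_cat addnA leq_addr.
by move=> j Hj; rewrite nth_cat ltnNge leq_addr /= addKn nth_cat Hj.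
Qed.

Lemma infix_take_drop (T : eqType) (s : seq T) i l : infix (take l (drop i s)) s.
Proof.
apply/infixP; exists (take i s), (drop l (drop i s)).
by rewrite cat_take_drop cat_take_drop.
Qed.

(** * Occurrences of a marker in a periodic word *)

Definition min_period (B : Type) (X : nat -> B) (p : nat) : Prop :=
  [/\ 0 < p, forall i, X (i + p) = X i
    & forall q, 0 < q -> (forall i, X (i + q) = X i) -> p <= q].

Definition slice (B : Type) (X : nat -> B) (o l : nat) : seq B := mkseq (fun i => X (o + i)) l.

Section MarkList.
Variables (mk : pred nat) (N : nat).
Let Pos := [seq o <- iota 0 N | mk o].

Lemma marks_sorted : sorted ltn Pos.
Proof. by apply: sorted_filter; [exact: ltn_trans | exact: iota_ltn_sorted]. Qed.

Lemma mem_marks o : (o \in Pos) = mk o && (o < N).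
Proof. by rewrite mem_filter mem_iota add0n. Qed.

Lemma nth_marks j : j < size Pos -> mk (nth 0 Pos j) /\ nth 0 Pos j < N.
Proof. by move=> Hj; apply/andP; rewrite -mem_marks mem_nth. Qed.

Lemma marks_index o : mk o -> o < N -> exists2 i, i < size Pos & nth 0 Pos i = o.
Proof. by move=> mo oN; apply/(nthP 0); rewrite mem_marks mo. Qed.

Lemma marks_lt i j : i < j -> j < size Pos -> nth 0 Pos i < nth 0 Pos j.
Proof.
move=> ij Hj; have := sorted_ltn_nth ltn_trans 0 marks_sorted.
by move/(_ i j); rewrite !inE; apply=> //; apply: ltn_trans Hj.
Qed.

Lemma marks_next j o : j.+1 < size Pos -> nth 0 Pos j < o -> mk o -> nth 0 Pos j.+1 <= o.
Proof.
move=> Hj Ho mo; rewrite leqNgt; apply/negP => H.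
have [_ HN] := nth_marks Hj.
have [|i Hi E] := marks_index mo; first exact: ltn_trans HN.
rewrite -E in Ho H.
case: (ltngtP i j) => ij.
- have := marks_lt ij (ltnW Hj); lia.
- case: (ltngtP i j.+1) => ij2; first lia.
  + have := marks_lt ij2 Hi; lia.
  + by subst i; lia.
- by subst i; lia.
Qed.

Lemma marks_locate x J : J < size Pos -> nth 0 Pos 0 <= x < nth 0 Pos J ->
  exists2 j, j < J & nth 0 Pos j <= x < nth 0 Pos j.+1.
Proof.
elim: J => [|J IH] HJ /andP[H1 H2]; first lia.
case: (ltnP x (nth 0 Pos J)) => H3.
  have [|j Hj H] := IH (ltnW HJ); first by rewrite H1.
  by exists j => //; lia.
by exists J => //; rewrite H3.
Qed.

Lemma marks_spaced lam : (forall o o', mk o -> mk o' -> o < o' -> o + lam <= o') ->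
  forall j l, j + l < size Pos -> nth 0 Pos j + l * lam <= nth 0 Pos (j + l).
Proof.
move=> sp j; elim=> [|l IH] H; first by rewrite !addn0.
have H1 : j + l < size Pos by lia.
have := IH H1; have [m1 _] := nth_marks H1; have [m2 _] := nth_marks H.
have := sp _ _ m1 m2 (marks_lt (_ : j + l < j + l.+1) H).
by rewrite mulSn; lia.
Qed.

Lemma marks_size G : (forall x, exists2 o, mk o & x < o <= x + G) ->
  forall J, J.+1 * G < N -> J < size Pos /\ nth 0 Pos J <= J.+1 * G.
Proof.
move=> gap; elim=> [|J IH] H.
  have [o mo Ho] := gap 0.
  have [|[|i] Hi E] := marks_index mo; first lia.
    by rewrite E; split; lia.
  have := @marks_lt 0 i.+1 isT Hi; rewrite E; lia.
have H1 : J.+1 * G < N by rewrite mulSn in H; lia.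
have [H2 H3] := IH H1.
have [o mo Ho] := gap (nth 0 Pos J).
have [|i Hi E] := marks_index mo; first by rewrite (mulSn J.+1) in H; lia.
have H4 : J < i.
  case: (ltngtP J i) => // H5.
    have := marks_lt H5 H2; rewrite E; lia.
  by rewrite -H5 in E; lia.
have H5 : J.+1 < size Pos by lia.
split => //; have := @marks_next J o H5; rewrite (mulSn J.+1); lia.
Qed.

End MarkList.

Section MinPeriod.
Variables (B : Type) (X : nat -> B) (p : nat).
Hypothesis Xp : min_period X p.

Let p_gt0 : 0 < p. Proof. by case: Xp. Qed.

Lemma Xmul i k : X (i + k * p) = X i.
Proof.
elim: k => [|k IH]; first by rewrite addn0.
by case: Xp => _ H _; rewrite mulSn (addnC p) addnA H.
Qed.

(** Periodicity moves any position into a given stretch of [p] positions without changing what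
    follows it; arguments about all of [X] can thus be carried out where [X] is known to be an
    image. *)
Lemma X_shift a x : exists2 x', a <= x' < a + p & forall d, X (x + d) = X (x' + d).
Proof.
have Hp := p_gt0.
exists (a + (x + a * p - a) %% p).
  by have := ltn_pmod (x + a * p - a) p_gt0; lia.
move=> d; rewrite -(Xmul _ a) -(Xmul (_ + d) ((x + a * p - a) %/ p)); congr X.
have := divn_eq (x + a * p - a) p; nia.
Qed.

(** Minimality of [p] turns a shift that is checked on a single stretch of length [p] into the bound
    [p <= T]. *)
Lemma X_period a T : (forall x, a <= x < a + p -> X (x + T) = X x) -> 0 < T -> p <= T.
Proof.
move=> H T0; case: (Xp) => _ _; apply=> // x.
have [x' /H H' E] := X_shift a x.
by rewrite E H' -(addn0 x) E addn0.
Qed.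

End MinPeriod.

(** * Occurrences of the marker on one level *)

Section Level.
Variables (A B : eqType) (x0 : B) (X : nat -> B) (p : nat).
Hypothesis Xp : min_period X p.
Variables (Y y : seq A) (r0 R1 c ylen : nat).
Hypothesis c_gt0 : 0 < c.
Hypothesis y_short : size y <= ylen.
(** The length [m = k2 * lam] is at least that of the marker image [z] plus the largest gap [G]
    between marks, so [m] letters after a mark show the next mark. The image of [r2] letters of [Y]
    covers its first block and [m] letters beyond it. *)
Let k2 := (R1.+1 + ylen) * c.
Let r2 := (r0 * k2).+1.
Let I := size Y - r2.
Hypothesis Y_long : r2 + r0 * ((2 * p + 4) * (R1.+1 * c)) <= size Y.
Hypothesis y_has : forall w, infix w Y -> size w = r0.+1 -> infix w y.
Hypothesis has_y : forall w, infix w Y -> size w = R1 -> infix y w.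
Variables (g : A -> seq B) (lam : nat).
Hypothesis lam_gt0 : 0 < lam.
Hypothesis lam_p : lam <= p.
Hypothesis g_le : {in Y, forall b, size (g b) <= c * lam}.
Hypothesis g_win : forall w, infix w Y -> size w = r0 -> lam <= size (morph g w).
Let w := morph g Y.
Hypothesis w_X : forall i, i < size w -> nth x0 w i = X i.
Let z := morph g y.
Let bd i := size (morph g (take i Y)).
Let G := R1.+1 * c * lam.
Let m := k2 * lam.
Let mk o := slice X o (size z) == z.
Let Pos := [seq o <- iota 0 (bd I) | mk o].

Let p_gt0 : 0 < p. Proof. by case: Xp. Qed.

Lemma bd_mono i j : i <= j -> bd i <= bd j.
Proof. exact: size_morph_take_le. Qed.

Lemma bd_cat i l : bd (i + l) = bd i + size (morph g (take l (drop i Y))).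
Proof. by rewrite /bd takeD morph_cat size_cat. Qed.

Lemma bd_le i l : bd (i + l) <= bd i + l * (c * lam).
Proof.
rewrite bd_cat leq_add2l; apply: leq_trans (_ : size (take l (drop i Y)) * (c * lam) <= _).
  by apply: size_morph_le_in => b /mem_take/mem_drop; exact: g_le.
by rewrite leq_mul2r size_take_min geq_minl orbT.
Qed.

Lemma bd_ge k i : i + r0 * k <= size Y -> bd i + k * lam <= bd (i + r0 * k).
Proof.
elim: k => [|k IH] H; first by rewrite muln0 !addn0.
have H1 : i + r0 * k <= size Y by rewrite mulnS in H; lia.
have -> : i + r0 * k.+1 = i + r0 * k + r0 by rewrite mulnS; lia.
rewrite bd_cat mulSn addnCA addnC leq_add ?IH //.
apply: g_win; first exact: infix_take_drop.
by rewrite size_take_min size_drop; rewrite mulnS in H; lia.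
Qed.

Lemma size_w : bd (size Y) = size w.
Proof. by rewrite /bd take_size. Qed.

Lemma k2_gt0 : 0 < k2. Proof. by rewrite /k2; nia. Qed.

(** This leaves room for more than [2 * p + 2] marks, so that one can start at any of the first [p]
    marks and still move on by up to [p] marks. *)
Lemma I_large : (2 * p + 4) * G <= bd I.
Proof.
have H : I = 0 + r0 * ((2 * p + 4) * (R1.+1 * c)) + (I - r0 * ((2 * p + 4) * (R1.+1 * c))).
  by rewrite /I; lia.
rewrite H; apply: leq_trans (bd_mono (leq_addr _ _)).
have H2 : 0 + r0 * ((2 * p + 4) * (R1.+1 * c)) <= size Y by lia.
apply: leq_trans (bd_ge H2); rewrite /G !mulnA; lia.
Qed.

Lemma p_lt_bdI : 2 * p < bd I.
Proof. have := I_large; rewrite /G; nia. Qed.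

Lemma take_drop_w o l : o + l <= size w -> take l (drop o w) = slice X o l.
Proof.
move=> H; apply: (@eq_from_nth _ x0).
  by rewrite size_mkseq size_take_min size_drop; lia.
move=> i; rewrite size_take_min size_drop => Hi.
rewrite nth_take ?nth_drop ?nth_mkseq ?w_X //; lia.
Qed.

Lemma nth_slice o l i : i < l -> nth x0 (slice X o l) i = X (o + i).
Proof. by move=> H; rewrite nth_mkseq. Qed.

Lemma mk_nth o i : mk o -> i < size z -> X (o + i) = nth x0 z i.
Proof. by move=> /eqP E Hi; rewrite -E nth_slice. Qed.

Lemma r0_lt_r2 : r0 < r2.
Proof. rewrite /r2; have := k2_gt0; nia. Qed.

Lemma r0_gt0 : 0 < r0.
Proof.
rewrite lt0n; apply/eqP => E; have := g_win (infix0s Y).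
by rewrite E => /(_ erefl); rewrite leqNgt lam_gt0.
Qed.

Lemma R1_lt_r2 : R1 < r2.
Proof. rewrite /r2 /k2; have := r0_gt0; nia. Qed.

Lemma block x : x < bd I -> exists2 i, i < I & bd i <= x < bd i.+1.
Proof.
move=> H; have [] := @morph_locate _ _ g (take I Y) x H.
rewrite size_take_min => i Hi; rewrite !take_takel; try lia.
by move=> H'; exists i => //; lia.
Qed.

(* If two occurrences of [z] were closer than [lam], then [z] and hence, since
   [z] contains all short factors of [X], the whole of [X] would have a period
   smaller than [p]. *)
Lemma mk_spaced o o' : mk o -> mk o' -> o < o' -> o + lam <= o'.
Proof.
move=> mo mo' oo'; rewrite leqNgt; apply/negP => H.
set e := o' - o.
have z_e i : i + e < size z -> nth x0 z i = nth x0 z (i + e).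
  move=> Hi; rewrite -(mk_nth mo Hi) -(@mk_nth o' i mo'); last lia.
  by congr X; rewrite /e; lia.
suff : p <= e by rewrite /e; lia.
apply: (X_period Xp (a := 0)); last by rewrite /e; lia.
move=> x Hx.
have [|i Hi /andP[B1 B2]] := @block x; first by apply: leq_ltn_trans p_lt_bdI; lia.
have HI := r0_lt_r2; have HI2 : i + r0.+1 <= size Y by move: Hi; rewrite /I; lia.
(* The [r0] letters after the block of [x] have an image of length at least [lam > e]. So [x] and
   [x + e] both fall into the image of [W], and this image occurs in [z], where the shift by [e] is
   known. *)
pose W := take r0.+1 (drop i Y).
have sW : size W = r0.+1 by rewrite size_take_min size_drop; lia.
have /(infix_morph g)/(infix_nth x0)[t Ht Et] := y_has (infix_take_drop Y i r0.+1) sW.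
rewrite -/W in Ht Et.
have W_size : bd i.+1 + lam <= bd i + size (morph g W).
  rewrite -bd_cat; have := @bd_ge 1 i.+1; rewrite muln1 mul1n addSnnS; apply; lia.
have WX d : d < size (morph g W) -> nth x0 (morph g W) d = X (bd i + d).
  move=> Hd; rewrite -w_X.
    rewrite -nth_drop /w /bd drop_morph -(cat_take_drop r0.+1 (drop i Y)) morph_cat nth_cat.
    by rewrite -/W Hd.
  have : bd (i + r0.+1) <= size w by rewrite -size_w; apply: bd_mono.
  by rewrite bd_cat -/W; lia.
have E1 : X x = nth x0 z (t + (x - bd i)).
  by rewrite -Et ?WX; solve [lia | congr X; lia].
have E2 : X (x + e) = nth x0 z (t + (x - bd i) + e).
  by rewrite -addnA -Et ?WX /e; solve [lia | congr X; lia].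
by rewrite E2 E1 -z_e //; rewrite /z /e; lia.
Qed.

(** After [x] is moved into the range of [Y], the [R1] letters following its block contain [y],
    whose image is an occurrence of [z]. A block together with the images of [R1] letters has length
    at most [G]. *)
Lemma mk_gap x : exists2 o, mk o & x < o <= x + G.
Proof.
have [x' Hx' Ex] := X_shift Xp 0 x.
have [|i Hi /andP[B1 B2]] := @block x'; first by apply: leq_ltn_trans p_lt_bdI; lia.
have HR := R1_lt_r2.
have sW : size (take R1 (drop i.+1 Y)) = R1.
  by rewrite size_take_min size_drop; move: Hi; rewrite /I; lia.
have /infixP[u [v E]] := has_y (infix_take_drop Y i.+1 R1) sW.
have Eu : bd (i.+1 + size u) = bd i.+1 + size (morph g u).
  by rewrite bd_cat -(take_takel _ (_ : size u <= R1)) ?E ?take_size_cat // -sW E !size_cat; lia.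
have Hu : size u <= R1 by rewrite -sW E size_cat; lia.
have b2 : bd (i.+1 + size u) + size z <= bd (i.+1 + R1).
  by rewrite Eu (bd_cat i.+1 R1) E !morph_cat !size_cat -/z; lia.
have b3 : bd (i.+1 + R1) <= bd i + G.
  by have := bd_le i R1.+1; rewrite -addSnnS /G !mulnA.
have m' : mk (bd (i.+1 + size u)).
  rewrite /mk -take_drop_w; last first.
    apply: leq_trans b2 _; rewrite -size_w; apply: bd_mono; move: Hi; rewrite /I; lia.
  rewrite /w /bd drop_morph (addnC i.+1) -drop_drop -(cat_take_drop R1 (drop i.+1 Y)) E.
  by rewrite -!catA drop_size_cat // morph_cat take_size_cat.
have b1 := bd_mono (leq_addr (size u) i.+1).
exists (x + (bd (i.+1 + size u) - x')); last lia.
move: m'; rewrite /mk => /eqP {2}<-; apply/eqP; apply: eq_mkseq => j.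
rewrite -addnA Ex; congr X; lia.
Qed.

Lemma size_z : size z + G <= m.
Proof.
suff: size z <= ylen * (c * lam) by rewrite /m /k2 /G; nia.
apply: leq_trans (_ : size y * (c * lam) <= _); last by rewrite leq_mul2r y_short orbT.
apply: size_morph_le_in => b by_; apply: g_le.
have HR : R1 <= size Y.
  by have := R1_lt_r2; lia.
have /infixP[u [v E]] := @has_y (take R1 (drop 0 Y)) (infix_take_drop _ _ _)
   (ltac:(by rewrite drop0 size_takel)).
by apply: (@mem_take R1); rewrite -{1}(drop0 Y) E !mem_cat by_ !orbT.
Qed.

Lemma Pos_size : 2 * p + 2 < size Pos.
Proof.
have [|//] := @marks_size mk (bd I) G mk_gap (2 * p + 2).
apply: leq_trans I_large; rewrite /G; nia.
Qed.

Lemma Pos_gap j : j.+1 < size Pos -> nth 0 Pos j.+1 <= nth 0 Pos j + G.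
Proof.
move=> Hj; have [o mo Ho] := mk_gap (nth 0 Pos j).
have := marks_next Hj _ mo; rewrite -/Pos; lia.
Qed.

Lemma slice_sub o o' l d l' : slice X o l = slice X o' l -> d + l' <= l ->
  slice X (o + d) l' = slice X (o' + d) l'.
Proof.
move=> E H; apply: (@eq_from_nth _ x0); rewrite !size_mkseq // => i Hi.
rewrite !nth_slice // -!addnA -(@nth_slice o l) ?E ?nth_slice //; lia.
Qed.

(** Contents are long enough to show the next mark, so if they repeat after [q] marks, the gaps
    between marks repeat as well. Moving on by [q] marks is then a translation by a constant [T], at
    most [q * G], and since the contents cover everything between marks, [T] is a period. *)
Lemma upper_period q : 0 < q <= p ->
  (forall j, j + q < size Pos -> slice X (nth 0 Pos j) m = slice X (nth 0 Pos (j + q)) m) ->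
  p <= q * G.
Proof.
move=> /andP[q0 qp] H; have Hs := Pos_size; have Hz := size_z.
pose T := nth 0 Pos q - nth 0 Pos 0.
have T0 : nth 0 Pos 0 < nth 0 Pos q by apply: marks_lt; rewrite -/Pos; lia.
have step j : j + q < size Pos -> nth 0 Pos (j + q) = nth 0 Pos j + T.
  elim: j => [|j IH] Hj; first by rewrite add0n /T; lia.
  have H1 : j + q < size Pos by lia.
  have {}IH := IH H1; have {H1}E := H _ H1.
  have Hj1 : j.+1 < size Pos by lia.
  have Hjq : (j + q).+1 < size Pos by lia.
  have G1 := Pos_gap Hj1; have G2 := Pos_gap Hjq.
  have [m1 _] := nth_marks Hj1; have [m2 _] := nth_marks Hjq.
  have l1 := marks_lt (ltnSn j) Hj1; have l2 := marks_lt (ltnSn (j + q)) Hjq.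
  rewrite -/Pos in m1 m2 l1 l2.
  pose d := nth 0 Pos j.+1 - nth 0 Pos j.
  pose e := nth 0 Pos (j + q).+1 - nth 0 Pos (j + q).
  (* Equal contents carry the next mark from either place to the other; the two inequalities give
     equal gaps. *)
  have md : mk (nth 0 Pos (j + q) + d).
    rewrite /mk -(slice_sub E (_ : d + size z <= m)); last by rewrite /d; lia.
    by have -> : nth 0 Pos j + d = nth 0 Pos j.+1 by rewrite /d; lia.
  have me : mk (nth 0 Pos j + e).
    rewrite /mk (slice_sub E (_ : e + size z <= m)); last by rewrite /e; lia.
    by have -> : nth 0 Pos (j + q) + e = nth 0 Pos (j + q).+1 by rewrite /e; lia.
  have := marks_next Hj1 _ me; have := marks_next Hjq _ md.
  by rewrite -/Pos addSn /d /e; lia.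
have TG : forall l, l <= q -> nth 0 Pos l <= nth 0 Pos 0 + l * G.
  elim=> [|l IH] Hl; first by rewrite addn0.
  have := @Pos_gap l; have := IH (ltnW Hl); rewrite mulSn; lia.
have := TG q (leqnn q).
suff : p <= T by rewrite /T; lia.
apply: (X_period Xp (a := nth 0 Pos 0)); last by rewrite /T; lia.
move=> x Hx.
have sp := marks_spaced (fun o o' => @mk_spaced o o').
(* The first [p] gaps, each at least [lam >= 1], cover a full period, so [x] lies between two marks
   of index at most [p]. *)
have HP : nth 0 Pos 0 + p * lam <= nth 0 Pos (0 + p) by apply: sp; rewrite -/Pos; lia.
have [||j Hj /andP[J1 J2]] := @marks_locate mk (bd I) x p.
- by rewrite -/Pos; lia.
- by rewrite -/Pos; have := leq_pmulr p lam_gt0; rewrite add0n in HP; lia.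
rewrite -/Pos in J1 J2.
have Hj1 : j.+1 < size Pos by lia.
have G1 := Pos_gap Hj1.
have Hjq : j + q < size Pos by lia.
have xm : x - nth 0 Pos j < m by lia.
have := congr1 (fun s => nth x0 s (x - nth 0 Pos j)) (H j Hjq).
rewrite !nth_slice // (step _ Hjq).
have -> : nth 0 Pos j + (x - nth 0 Pos j) = x by lia.
by have -> : nth 0 Pos j + T + (x - nth 0 Pos j) = x + T by lia.
Qed.

(** Here [q] is the number of marks per period: the translate by [p] of the first mark is the mark
    of index [q], and the spacing of marks gives [q * lam <= p]. Translation by [p] preserves marks,
    so it advances every index by [q]. *)
Lemma lower_period : exists2 q, 0 < q <= p & q * lam <= p /\
  (forall j, j + q < size Pos -> slice X (nth 0 Pos j) m = slice X (nth 0 Pos (j + q)) m).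
Proof.
have Xper : forall i, X (i + p) = X i by case: Xp.
have Hs := Pos_size.
have mkp o : mk (o + p) = mk o.
  rewrite /mk; congr (_ == _); apply: eq_mkseq => i.
  by rewrite addnAC Xper.
have Il := I_large.
have GI : 0 < G by rewrite /G; nia.
have [_ P0G] := @marks_size mk (bd I) G mk_gap 0 (ltac:(nia)).
rewrite -/Pos in P0G.
have [|m0 _] := @nth_marks mk (bd I) 0; first by rewrite -/Pos; lia.
rewrite -/Pos in m0.
have [||q qs Eq] := @marks_index mk (bd I) (nth 0 Pos 0 + p).
- by rewrite mkp.
- by nia.
rewrite -/Pos in qs Eq.
have q0 : 0 < q.
  by rewrite lt0n; apply/eqP => E; move: Eq; rewrite E; have := p_gt0; lia.
have sp := marks_spaced (fun o o' => @mk_spaced o o').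
have ql : q * lam <= p.
  by have := sp (bd I) 0 q qs; rewrite add0n -/Pos Eq; lia.
exists q; first by rewrite q0; nia.
split=> // j Hj.
suff -> : nth 0 Pos (j + q) = nth 0 Pos j + p.
  by apply: eq_mkseq => i; rewrite addnAC Xper.
elim: j Hj => [|j IH] Hj; first by [].
have {}IH := IH (ltnW Hj).
have Hj1 : j.+1 < size Pos by lia.
have Hjq : (j + q).+1 < size Pos by lia.
have [m1 _] := nth_marks Hj1; have [m2 _] := nth_marks Hjq.
have l1 := marks_lt (ltnSn j) Hj1; have l2 := marks_lt (ltnSn (j + q)) Hjq.
rewrite -/Pos in m1 m2 l1 l2.
have := @marks_next mk (bd I) (j + q) (nth 0 Pos j.+1 + p) Hjq.
rewrite -/Pos mkp m1 IH => /(_ (ltac:(lia)) isT) U.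
have := @marks_next mk (bd I) j (nth 0 Pos (j + q).+1 - p) Hj1.
rewrite -/Pos -mkp subnK; last lia.
by rewrite m2 addSn; lia.
Qed.

(** What follows the marks in the image of the first letter of [W], computed from [W] and [g]
    without reference to a position in [X]. *)
Definition contents (W : seq A) : seq (seq B) :=
  [seq take m (drop o (morph g W)) |
    o <- iota 0 (size (morph g (take 1 W))) & take (size z) (drop o (morph g W)) == z].

Lemma contents_E i : i < I ->
  contents (take r2 (drop i Y)) = [seq slice X o m | o <- iota (bd i) (bd i.+1 - bd i) & mk o].
Proof.
move=> Hi; rewrite /contents take_takel //.
have -> : size (morph g (take 1 (drop i Y))) = bd i.+1 - bd i.
  by rewrite -(addn1 i) bd_cat addKn.
have HiY : i + r2 <= size Y by move: Hi; rewrite /I; lia.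
have sW : bd i.+1 + m <= bd i + size (morph g (take r2 (drop i Y))).
  rewrite -bd_cat /r2 -addSnnS /m.
  by apply: bd_ge; rewrite /r2 in HiY; lia.
have := bd_mono (leqnSn i).
have bw : bd (i + r2) <= size w by rewrite -size_w; exact: bd_mono.
rewrite bd_cat in bw.
have td o l : o < bd i.+1 - bd i -> l <= m ->
   take l (drop o (morph g (take r2 (drop i Y)))) = slice X (bd i + o) l.
  move=> Ho Hl; rewrite -take_drop_w; last lia.
  rewrite (addnC (bd i)) -drop_drop /w /bd drop_morph -{2}(cat_take_drop r2 (drop i Y)) morph_cat.
  rewrite drop_cat ifT; last lia.
  by rewrite takel_cat // size_drop; lia.
move=> Hb; rewrite -{2}(addn0 (bd i)) iotaDl filter_map -map_comp.
have E : {in iota 0 (bd i.+1 - bd i), (fun o => take (size z) (drop o (morph g (take r2 (drop i Y)))) == z) =1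
   (fun o => mk (bd i + o))}.
  by move=> o; rewrite mem_iota => Ho; rewrite td //; have := size_z; lia.
rewrite (eq_in_filter E); apply/eq_in_map => o; rewrite mem_filter mem_iota => Ho /=.
by rewrite td //; lia.
Qed.

(** Marks are grouped by the block in which they begin. The windows on the right come from [Y],
    which stays the same when [g] passes to another level. *)
Lemma contents_flatten :
  [seq slice X o m | o <- Pos] = flatten [seq contents (take r2 (drop i Y)) | i <- iota 0 I].
Proof.
rewrite /Pos; suff: forall I', I' <= I ->
  [seq slice X o m | o <- iota 0 (bd I') & mk o]
   = flatten [seq contents (take r2 (drop i Y)) | i <- iota 0 I'] by apply.
elim=> [|I' IH] HI; first by rewrite /bd take0.
rewrite -addn1 (iotaD 0 I') map_cat flatten_cat -IH ?(ltnW HI) //= cats0 add0n contents_E //.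
have := bd_mono (leqnSn I') => Hb.
by rewrite -map_cat -filter_cat -{2}(add0n (bd I')) -iotaD addn1 subnKC.
Qed.

(** A block has at most [c * lam] letters, and marks are at least [lam] apart. *)
Lemma size_contents i : i < I -> size (contents (take r2 (drop i Y))) <= c.
Proof.
move=> Hi; rewrite contents_E // size_map.
have -> : iota (bd i) (bd i.+1 - bd i) = map (addn (bd i)) (iota 0 (bd i.+1 - bd i)).
  by rewrite -iotaDl addn0.
rewrite filter_map size_map.
set s := filter _ _.
rewrite leqNgt; apply/negP => Hc.
have sp : forall o o', mk (bd i + o) -> mk (bd i + o') -> o < o' -> o + lam <= o'.
  by move=> o o' H1 H2 oo'; have := mk_spaced H1 H2; lia.
have := @marks_spaced (fun o => mk (bd i + o)) (bd i.+1 - bd i) lam sp 0 c.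
rewrite -/s add0n => /(_ Hc) H1.
have [_ H2] := @nth_marks (fun o => mk (bd i + o)) (bd i.+1 - bd i) c Hc.
have := bd_le i 1; rewrite mul1n addn1 => H3; rewrite -/s in H2; lia.
Qed.

End Level.

(** * Comparison of two levels *)

Lemma min_period_shift (B : Type) (X : nat -> B) p s :
  min_period X p -> min_period (fun i => X (s + i)) p.
Proof.
case=> p0 H1 H2; split=> // [i|q q0 Hq]; first by rewrite addnA H1.
apply: H2 => // i.
have Hs k j : X (j + k * p) = X j.
  by elim: k => [|k IH]; rewrite ?addn0 // mulSn (addnC p) addnA H1.
rewrite -(Hs s i) -(Hs s (i + q)) -addnA (addnC q) addnA.
have -> : i + s * p = s + (i + s * p - s) by nia.
by rewrite -Hq; congr X; lia.
Qed.

Section TwoLevels.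
Variables (A : finType) (B : eqType) (x0 : B) (X : nat -> B) (p : nat).
Hypothesis Xp : min_period X p.
Variables (Y y : seq A) (r0 R1 c ylen : nat).
Hypothesis c_gt0 : 0 < c.
Hypothesis y_short : size y <= ylen.
Let r2 := (r0 * ((R1.+1 + ylen) * c)).+1.
Let I := size Y - r2.
Hypothesis Y_long : r2 + r0 * ((2 * p + 4) * (R1.+1 * c)) <= size Y.
Hypothesis y_has : forall w, infix w Y -> size w = r0.+1 -> infix w y.
Hypothesis has_y : forall w, infix w Y -> size w = R1 -> infix y w.
Variables (J : nat) (g : nat -> A -> seq B) (lam s : nat -> nat).
Hypothesis lam_gt0 : forall j, j < J -> 0 < lam j.
Hypothesis lam_p : forall j, j < J -> lam j <= p.
Hypothesis g_le : forall j, j < J -> {in Y, forall b, size (g j b) <= c * lam j}.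
Hypothesis g_win : forall j, j < J ->
  forall w, infix w Y -> size w = r0 -> lam j <= size (morph (g j) w).
Hypothesis g_X : forall j, j < J ->
  forall i, i < size (morph (g j) Y) -> nth x0 (morph (g j) Y) i = X (s j + i).
Hypothesis lam_grow : forall i j, i < j -> j < J -> R1.+1 * c * lam i < lam j.

Let cont j := contents y R1 c ylen (g j) (lam j).
Let Q := #|A| ^ r2 * c.
Let contlist j := flatten [seq take c (cont j (W : r2.-tuple A)) | W <- enum {: r2.-tuple A}].
(** The datum of a level. Each content is named by its first index in [contlist], so the datum
    records which contents coincide but not what they are, and its type is the same for all levels;
    [ord_max] stands for a missing entry. Truncation to [c] entries in [contlist] keeps names below
    [Q] even when some tuples are not factors of [Y]. *)
Let data j : {ffun r2.-tuple A * 'I_c -> 'I_Q.+1} :=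
  [ffun Wa : r2.-tuple A * 'I_c =>
    if Wa.2 < size (cont j Wa.1) then inord (index (nth [::] (cont j Wa.1) Wa.2) (contlist j))
    else ord_max].

Lemma size_contlist j : size (contlist j) <= Q.
Proof.
rewrite /contlist /Q -(card_tuple r2 A) cardE; elim: (enum _) => //= W e IH.
by rewrite size_cat mulSn leq_add // size_take_min geq_minl.
Qed.

Lemma mem_contlist j (W : r2.-tuple A) u :
  size (cont j W) <= c -> u \in cont j W -> u \in contlist j.
Proof.
move=> H Hu; apply/flatten_mapP; exists W; first by rewrite mem_enum.
by rewrite take_oversize.
Qed.

Lemma data_eq i j (W : r2.-tuple A) : data i = data j ->
  size (cont i W) <= c -> size (cont j W) <= c ->
  [seq index u (contlist i) | u <- cont i W] = [seq index u (contlist j) | u <- cont j W].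
Proof.
move=> E Hi Hj.
have D k a (ac : a < c) : size (cont k W) <= c ->
  nat_of_ord (data k (W, Ordinal ac)) =
    if a < size (cont k W) then index (nth [::] (cont k W) a) (contlist k) else Q.
  move=> Hk; rewrite ffunE /=; case: ifP => // Ha; rewrite inordK //.
  by apply: leq_trans (leq_trans (_ : _ < size (contlist k)) (size_contlist k)) (leqnSn Q);
    rewrite index_mem; apply: (@mem_contlist _ W); rewrite ?mem_nth.
have ltQ k a : size (cont k W) <= c -> a < size (cont k W) ->
    index (nth [::] (cont k W) a) (contlist k) < Q.
  move=> Hk Ha; apply: leq_trans (size_contlist k).
  by rewrite index_mem; apply: (@mem_contlist _ W); rewrite ?mem_nth.
have S a : (a < size (cont i W)) = (a < size (cont j W)).
  case: (ltnP a c) => ac; last by apply/idP/idP; lia.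
  have := D i a ac Hi; rewrite E D //.
  case: ifP => H1; case: ifP => H2 //; first by move=> E2; have := ltQ j a Hj H1; lia.
  by move=> E2; have := ltQ i a Hi H2; lia.
have SE : size (cont i W) = size (cont j W).
  by have := S (size (cont i W)); have := S (size (cont j W)); lia.
apply: (@eq_from_nth _ 0); first by rewrite (size_map _ (cont i W)) (size_map _ (cont j W)).
move=> a; rewrite (size_map _ (cont i W)) => Ha.
rewrite !(nth_map [::]) -?SE //.
have ac : a < c by lia.
by have := D i a ac Hi; rewrite E D // Ha -SE Ha => ->.
Qed.

(** With equal data, the repetition after [q] marks found on level [j] transfers to level [i]. There
    it forces [p <= q * (R1.+1 * c * lam i)], while level [j] gives [q * lam j <= p], against
    [lam_grow]. *)
Lemma data_inj i j : i < j -> j < J -> data i <> data j.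
Proof.
move=> ij jJ E; have iJ := ltn_trans ij jJ.
have sz k : k < J -> forall i, i < I -> size (cont k (take r2 (drop i Y))) <= c.
  move=> kJ; apply: (size_contents (min_period_shift (s k) Xp) c_gt0 y_short Y_long y_has has_y
    (lam_gt0 kJ) (lam_p kJ) (g_le kJ) (g_win kJ) (g_X kJ)).
have cf k (kJ : k < J) := contents_flatten (min_period_shift (s k) Xp) c_gt0 y_short Y_long has_y
    (lam_gt0 kJ) (lam_p kJ) (g_le kJ) (g_win kJ) (g_X kJ).
have win a : a < I -> size (take r2 (drop a Y)) == r2.
  by move=> aI; rewrite size_take_min size_drop; apply/eqP; move: aI; rewrite /I; lia.
have up := upper_period (min_period_shift (s i) Xp) c_gt0 y_short Y_long y_has has_y
    (lam_gt0 iJ) (lam_p iJ) (g_le iJ) (g_win iJ) (g_X iJ).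
have [q /[dup] Hq /andP[q0 _] [qp per]] := lower_period (min_period_shift (s j) Xp) c_gt0 y_short Y_long y_has has_y
    (lam_gt0 jJ) (lam_p jJ) (g_le jJ) (g_win jJ) (g_X jJ).
suff : p <= q * (R1.+1 * c * lam i) by have := lam_grow ij jJ; nia.
apply: up => //.
move: per (cf _ iJ) (cf _ jJ) => {cf}.
set Pi := [seq o <- iota 0 _ | slice (fun _ => X (s i + _)) _ _ == _].
set Pj := [seq o <- iota 0 _ | slice (fun _ => X (s j + _)) _ _ == _].
set mi := _ * lam i; set mj := _ * lam j.
move=> per cfi cfj.
(* Both levels read the same windows of [Y], so the sequences of names along the marks agree. *)
have L : [seq index u (contlist i) | u <- [seq slice (fun a => X (s i + a)) o mi | o <- Pi]] =
  [seq index u (contlist j) | u <- [seq slice (fun a => X (s j + a)) o mj | o <- Pj]].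
  rewrite cfi cfj -/I !map_flatten -!map_comp; congr flatten.
  apply/eq_in_map => a; rewrite mem_iota add0n => aI /=.
  by apply: (data_eq (W := Tuple (win a aI)) E); apply: sz.
have SE : size Pi = size Pj by have := congr1 size L; rewrite !size_map.
move=> a Ha.
have mem b : b < size Pi -> slice (fun a => X (s i + a)) (nth 0 Pi b) mi \in contlist i.
  move=> Hb.
  have : slice (fun a => X (s i + a)) (nth 0 Pi b) mi \in [seq slice (fun a => X (s i + a)) o mi | o <- Pi].
    by apply: map_f; apply: mem_nth.
  rewrite cfi -/I => /flatten_mapP[d]; rewrite mem_iota add0n => dI.
  by apply: (@mem_contlist _ (Tuple (win d dI))); apply: sz.
have Nk b : b < size Pi -> index (slice (fun a => X (s i + a)) (nth 0 Pi b) mi) (contlist i) =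
   index (slice (fun a => X (s j + a)) (nth 0 Pj b) mj) (contlist j).
  move=> Hb; have := congr1 (fun t => nth 0 t b) L.
  by rewrite -!map_comp !(nth_map 0) ?size_map // -?SE.
have H2 : a < size Pi by lia.
(* The contents agree on level [j], hence so do their names on both levels; on level [i] a name
   determines its content. *)
have : index (slice (fun a => X (s i + a)) (nth 0 Pi a) mi) (contlist i) =
  index (slice (fun a => X (s i + a)) (nth 0 Pi (a + q)) mi) (contlist i).
  by rewrite !Nk // per // -SE.
move=> Ei.
rewrite -(nth_index [::] (mem _ H2)) Ei.
by rewrite nth_index // mem.
Qed.

Lemma levels_bound : J <= Q.+1 ^ (#|A| ^ r2 * c).
Proof.
have <- : #|{ffun r2.-tuple A * 'I_c -> 'I_Q.+1}| = Q.+1 ^ (#|A| ^ r2 * c).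
  by rewrite card_ffun card_ord card_prod card_tuple card_ord.
rewrite -{1}(card_ord J).
apply: (@leq_card _ _ (fun j : 'I_J => data j)) => i j E; apply: val_inj => /=.
by case: (ltngtP i j) => // ij; case: (data_inj ij).
Qed.

End TwoLevels.

(** * Splitting images of morphisms *)

(** Take [c] with the fewest successors in [S]. By transitivity the successors of a successor of [c]
    are among those of [c], so by minimality they are the same set. *)
Lemma terminal_class (A : finType) (e : rel A) (S : pred A) (a : A) :
  transitive e -> S a -> (forall x, S x -> exists2 x', S x' & e x x') ->
  exists2 c, S c & forall x x', S x -> S x' -> e c x -> e c x' -> e x x'.
Proof.
move=> tr Sa step.
pose R x := [set x' | S x' & e x x'].
have [c Sc cmin] := arg_minnP (fun x => #|R x|) Sa.
exists c => // x x' Sx Sx' cx cx'.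
have sub : R x \subset R c.
  by apply/subsetP => t; rewrite !inE => /andP[-> xt]; exact: tr cx xt.
have : x' \in R c by rewrite inE Sx'.
by rewrite -(eqP (_ : R x == R c)) ?inE ?Sx' // eqEcard sub cmin.
Qed.

Lemma rev_morph (A B : Type) (f : A -> seq B) s :
  rev (morph f s) = morph (fun b => rev (f b)) (rev s).
Proof.
elim: s => // b s IH.
by rewrite morph_cons rev_cat IH rev_cons -cats1 morph_cat morph1.
Qed.

Lemma rev_pw (A : Type) (f : A -> seq A) k b :
  rev (pw f k b) = pw (fun b => rev (f b)) k b.
Proof. by elim: k => // k IH; rewrite !pwS rev_morph IH. Qed.

Section LastSplit.
Variables (A : eqType) (G : pred A).
Definition last_in (x : A) (w : seq A) : A := nth x (rev w) (find G (rev w)).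
Definition trail (w : seq A) : seq A := rev (take (find G (rev w)) (rev w)).

Lemma trailE x w : has G w ->
  [/\ exists u, w = u ++ last_in x w :: trail w, G (last_in x w) & ~~ has G (trail w)].
Proof.
move=> H; have H' : has G (rev w) by rewrite has_rev.
split.
- exists (rev (drop (find G (rev w)).+1 (rev w))).
  rewrite -cat_rcons -rev_cons /trail /last_in -drop_nth -?has_find // -rev_cat cat_take_drop.
  by rewrite revK.
- exact: nth_find.
- rewrite /trail has_rev; apply/hasPn => y /(nthP x) [i].
  rewrite size_take -has_find H' => Hi <-.
  by rewrite nth_take // before_find.
Qed.
End LastSplit.

Lemma split_unique (A : eqType) (G : pred A) (u u' v v' : seq A) x x' :
  u ++ x :: v = u' ++ x' :: v' -> G x -> G x' -> ~~ has G v -> ~~ has G v' ->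
  [/\ u = u', x = x' & v = v'].
Proof.
elim: u u' => [|a u IH] [|a' u'] //=.
- by case=> -> ->.
- case=> _ -> _ Gx'; by rewrite has_cat /= Gx' orbT.
- case=> _ <- Gx _; by rewrite has_cat /= Gx orbT.
- case=> -> E Gx Gx' nv nv'.
  by have [-> -> ->] := IH _ E Gx Gx' nv nv'.
Qed.

Lemma morph_split (A B : Type) (f : A -> seq B) w u x v :
  morph f w = u ++ x :: v ->
  exists w1 b w2 u2 v2, [/\ w = w1 ++ b :: w2, f b = u2 ++ x :: v2,
     u = morph f w1 ++ u2 & v = v2 ++ morph f w2].
Proof.
elim: w u => [|b w IH] u; first by case: u.
rewrite morph_cons => E.
case: (ltnP (size u) (size (f b))) => H.
  exists [::], b, w, u, (drop (size u).+1 (f b)).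
  have E1 : take (size u).+1 (f b) = rcons u x.
    have := congr1 (take (size u).+1) E; rewrite takel_cat // => ->.
    by rewrite -cat_rcons take_size_cat // size_rcons.
  have E2 : f b = u ++ x :: drop (size u).+1 (f b).
    by rewrite -cat_rcons -E1 cat_take_drop.
  split=> //=.
  have E3 : drop (size u).+1 (u ++ x :: v) = v by rewrite -cat_rcons drop_size_cat ?size_rcons.
  rewrite -E3 -E drop_cat; case: ltnP => // H2.
  have H3 : size (f b) = (size u).+1 by lia.
  by rewrite -H3 subnn drop0 drop_size.
have Eu : u = f b ++ drop (size (f b)) u.
  rewrite -{1}(cat_take_drop (size (f b)) u); congr (_ ++ _).
  have := congr1 (take (size (f b))) E.
  by rewrite take_size_cat // takel_cat // => <-.
have E' : morph f w = drop (size (f b)) u ++ x :: v.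
  have := congr1 (drop (size (f b))) E.
  by rewrite drop_size_cat // => ->; rewrite {1}Eu -catA drop_size_cat.
have [w1 [b' [w2 [u2 [v2 [-> E1 E2 E3]]]]]] := IH _ E'.
exists (b :: w1), b', w2, u2, v2; split=> //.
by rewrite {1}Eu E2 morph_cons catA.
Qed.

Lemma nth_flatten_nseq (T : Type) (x0 : T) (v : seq T) k i : i + size v < k * size v ->
  nth x0 (flatten (nseq k v)) (i + size v) = nth x0 (flatten (nseq k v)) i.
Proof.
elim: k i => // k IH i Hi.
rewrite /= nth_cat ltnNge leq_addl /= addnK nth_cat.
case: ltnP => Hi2.
  case: k Hi {IH} => [|k] Hi; first by move: Hi; rewrite mul1n; lia.
  by rewrite /= nth_cat Hi2.
rewrite -(IH (i - size v)) ?subnK //; rewrite mulSn in Hi; lia.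
Qed.

Section Period.
Variables (B : eqType) (x0 : B) (X : nat -> B) (p : nat).
Hypothesis Xp : min_period X p.

(** Inside [p.+1] copies of [v] the shift by [size v] is valid on at least [p] consecutive
    positions. *)
Lemma power_min_period (v : seq B) s l : 0 < size v ->
  infix (flatten (nseq p.+1 v)) (slice X s l) -> p <= size v.
Proof.
move=> v0 /(infix_nth x0)[t].
have sf k : size (flatten (nseq k v)) = k * size v.
  by elim: k => //= k IH; rewrite size_cat IH mulSn.
rewrite sf size_mkseq => tl H.
have Hv := leq_pmulr p v0.
apply: (X_period Xp (a := s + t)) => // x Hx.
have Hx1 : x - (s + t) + size v < p.+1 * size v by rewrite mulSn; lia.
have := nth_flatten_nseq x0 Hx1; rewrite !H; try lia.
rewrite !nth_mkseq; try lia.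
by move=> E; transitivity (X (s + (t + (x - (s + t) + size v)))); [congr X; lia|
  rewrite E; congr X; lia].
Qed.
End Period.

(** * Runs of nongrowing letters *)

(** Pigeonhole on the first [#|A|.+1] iterates: after [#|A|] steps the orbit is on its cycle. *)
Lemma iter_cycle (A : finType) (f : A -> A) x :
  exists2 k, 0 < k <= #|A| & iter k f (iter #|A| f x) = iter #|A| f x.
Proof.
have /injectivePn[i [j ij E]] : ~~ injectiveb (fun i : 'I_#|A|.+1 => iter i f x).
  apply/negP => /injectiveP/leq_card; rewrite card_ord; lia.
wlog lt_ij : i j ij E / i < j.
  move=> H; case: (ltngtP i j) => [|ji|/val_inj e]; first exact: H.
    by apply: (H j i) => //; rewrite eq_sym.
  by rewrite e eqxx in ij.
exists (j - i); first by have := ltn_ord j; lia.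
rewrite -iterD.
have -> : j - i + #|A| = (#|A| - i) + j by have := ltn_ord j; lia.
by rewrite iterD -E -iterD; congr iter; have := ltn_ord i; lia.
Qed.

Section Trail.
Variables (A : finType) (Psi : A -> seq A) (wt : A -> nat) (G C : pred A).
Hypothesis Psi_gt0 : forall b, 0 < size (Psi b).
Hypothesis nongrow_closed : forall b x, ~~ G b -> x \in Psi b -> ~~ G x.
Hypothesis C_grow : forall b, C b -> has G (Psi b).
Hypothesis C_closed : forall b x, C b -> x \in Psi b -> G x -> C x.
Hypothesis no_trail : forall x k u v, C x -> 0 < k <= #|A| ->
  pw Psi k x = u ++ x :: v -> ~~ has G v -> v = [::].

Definition Last x := last_in G x (Psi x).
Definition Tail x := trail G (Psi x).
Definition weight (s : seq A) : nat := \sum_(x <- s) wt x.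
(** A potential: the weight of the runs still to be collected when the last growing letter is
    followed through the levels. The sum can stop at [#|A|] because by then [Last] has entered a
    cycle, where [Tail_cyclic] makes the tails empty. *)
Definition tail_weight x : nat := \sum_(i < #|A|) weight (Tail (iter i Last x)).

Lemma weight_cat s t : weight (s ++ t) = weight s + weight t.
Proof. exact: big_cat. Qed.

Lemma C_Last x : C x -> C (Last x).
Proof.
move=> Cx; have [[u E] GL _] := trailE x (C_grow Cx).
by rewrite -/(Last x) -/(Tail x) in E GL; apply: C_closed Cx _ GL; rewrite E mem_cat mem_head orbT.
Qed.

Lemma C_iter_Last i x : C x -> C (iter i Last x).
Proof. by move=> Cx; elim: i => //= i; exact: C_Last. Qed.

Lemma nongrow_pw k s : ~~ has G s -> ~~ has G (morph (pw Psi k) s).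
Proof.
move=> /hasPn H; apply/hasPn => x /mem_morphP[b /H nb].
elim: k x => [|k IH] x; first by rewrite pw0 inE => /eqP->.
rewrite pwS => /mem_morphP[c /IH nc]; exact: nongrow_closed.
Qed.

Lemma pw_gt0 k b : 0 < size (pw Psi k b).
Proof.
elim: k => // k IH; rewrite pwS.
by apply: leq_trans IH _; apply: size_morph_ge.
Qed.

Lemma pw_trail k x : C x -> exists u v, [/\ pw Psi k.+1 x = u ++ iter k.+1 Last x :: v,
   ~~ has G v & 0 < size (Tail x) -> 0 < size v].
Proof.
elim: k x => [|k IH] x Cx; have [[u E] GL nt] := trailE x (C_grow Cx).
  by exists u, (Tail x); rewrite pw1; split.
have [u' [v' [E' nv _]]] := IH _ (C_Last Cx).
exists (morph (pw Psi k.+1) u ++ u'), (v' ++ morph (pw Psi k.+1) (Tail x)); split.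
- by rewrite pwSr E morph_cat morph_cons -/(Last x) E' -iterSr -!catA.
- by rewrite has_cat negb_or nv nongrow_pw.
- move=> H; rewrite size_cat; apply: leq_trans (leq_addl _ _).
  by apply: leq_trans H (size_morph_ge _ _) => b; exact: pw_gt0.
Qed.

(** A letter on a cycle of [Last] reproduces itself in some power of [Psi], followed by a run at
    least as long as its own tail when that is nonempty; [no_trail] says that this run is empty. *)
Lemma Tail_cyclic x : C x -> Tail (iter #|A| Last x) = [::].
Proof.
move=> Cx; have [k Hk E] := iter_cycle Last x.
have Cy := C_iter_Last #|A| Cx.
case: k Hk E => // k Hk E.
have [u [v [E1 nv Hv]]] := pw_trail k Cy.
rewrite E in E1; have := no_trail Cy Hk E1 nv => v0.
by apply/eqP; rewrite -size_eq0 -leqn0 leqNgt; apply/negP => /Hv; rewrite v0.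
Qed.

Lemma tail_weight_step x : C x -> weight (Tail x) + tail_weight (Last x) <= tail_weight x.
Proof.
move=> Cx; rewrite /tail_weight.
have -> : \sum_(i < #|A|) weight (Tail (iter i Last (Last x))) =
   \sum_(i < #|A|) weight (Tail (iter i.+1 Last x)).
  by apply: eq_bigr => i _; rewrite -iterSr.
rewrite -(big_ord_recl #|A| (fun i => weight (Tail (iter i Last x)))) big_ord_recr /=.
by rewrite Tail_cyclic // /weight big_nil addn0.
Qed.

Lemma tail_weight_le (L : nat) x : (forall b, wt b <= L) -> (forall b, size (Psi b) <= L) ->
  tail_weight x <= #|A| * (L * L).
Proof.
move=> wL PL; rewrite /tail_weight -[X in X * _]card_ord -sum_nat_const.
apply: leq_sum => i _; set y := iter i Last x.
apply: leq_trans (_ : size (Tail y) * L <= _).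
  by rewrite /weight; elim: (Tail y) => [|b s IH]; rewrite ?big_nil ?big_cons //= mulSn leq_add.
rewrite leq_mul2r /Tail /trail size_rev size_take_min; apply/orP; right.
by apply: leq_trans (geq_minr _ _) _; rewrite size_rev.
Qed.
End Trail.

Lemma weight_morph (A : finType) (B : Type) (g : A -> seq B) s :
  weight (fun b => size (g b)) s = size (morph g s).
Proof.
by rewrite /weight; elim: s => [|b s IH]; rewrite ?big_nil // big_cons IH morph_cons size_cat.
Qed.

Lemma weight_rev (A : finType) (wt : A -> nat) s : weight wt (rev s) = weight wt s.
Proof. by rewrite /weight; apply/perm_big; rewrite perm_rev. Qed.

Lemma weight_le (A : finType) (wt : A -> nat) L s :
  (forall b, wt b <= L) -> weight wt s <= size s * L.
Proof.
move=> H; rewrite /weight; elim: s => [|b s IH]; rewrite ?big_nil ?big_cons //=.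
by rewrite mulSn leq_add.
Qed.

Section Runs.
Variables (A : finType) (Psi : A -> seq A) (wt : A -> nat) (L : nat) (G C : pred A).
Hypothesis Psi_gt0 : forall b, 0 < size (Psi b).
Hypothesis Psi_le : forall b, size (Psi b) <= L.
Hypothesis wt_le : forall b, wt b <= L.
Hypothesis wt_gt0 : forall b, 0 < wt b.
Hypothesis wt_fix : forall b, ~~ G b -> weight wt (Psi b) = wt b.
Hypothesis nongrow_closed : forall b x, ~~ G b -> x \in Psi b -> ~~ G x.
Hypothesis C_total : forall b x, C b -> C x -> x \in Psi b.
Hypothesis CG : forall b, C b -> G b.
Hypothesis C_closed : forall b x, C b -> x \in Psi b -> G x -> C x.
Hypothesis C_not_single : forall b, C b -> Psi b <> [:: b].
Hypothesis no_suffix_run : forall x k u v, C x -> 0 < k <= #|A| ->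
  pw Psi k x = u ++ x :: v -> ~~ has G v -> v = [::].
Hypothesis no_prefix_run : forall x k u v, C x -> 0 < k <= #|A| ->
  pw Psi k x = u ++ x :: v -> ~~ has G u -> u = [::].

Let C_grow b : C b -> has G (Psi b).
Proof. by move=> Cb; apply/hasP; exists b; rewrite ?C_total ?CG. Qed.

Let rPsi b := rev (Psi b).
Let sw := tail_weight Psi wt G.
Let pwt := tail_weight rPsi wt G.

Let sw_step := tail_weight_step wt Psi_gt0 nongrow_closed C_grow C_closed no_suffix_run.

Lemma rPsi_no_trail x k u v : C x -> 0 < k <= #|A| ->
  pw rPsi k x = u ++ x :: v -> ~~ has G v -> v = [::].
Proof.
move=> Cx Hk; rewrite -rev_pw => /(congr1 rev); rewrite revK rev_cat rev_cons cat_rcons => E nv.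
have := no_prefix_run Cx Hk E; rewrite has_rev => /(_ nv) /(congr1 rev).
by rewrite revK.
Qed.

Lemma rPsi_step x : C x -> weight wt (Tail rPsi G x) + pwt (Last rPsi G x) <= pwt x.
Proof.
apply: (@tail_weight_step _ rPsi wt G C) => //.
- by move=> b; rewrite size_rev.
- by move=> b y nb; rewrite mem_rev; exact: nongrow_closed.
- by move=> b Cb; rewrite has_rev C_grow.
- by move=> b y Cb; rewrite mem_rev; exact: C_closed.
- exact: rPsi_no_trail.
Qed.

Lemma C_pw t d x : C d -> x \in pw Psi t d -> G x -> C x.
Proof.
move=> Cd; elim: t x => [|t IH] x; first by rewrite pw0 inE => /eqP->.
rewrite pwS => /mem_morphP[b /IH Hb xb] Gx.
have Gb : G b by apply: contraLR Gx => nb; exact: nongrow_closed nb xb.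
exact: C_closed (Hb Gb) xb Gx.
Qed.

Lemma weight_nongrow s : ~~ has G s -> weight wt (morph Psi s) = weight wt s.
Proof.
elim: s => [|b s IH] //=; rewrite negb_or => /andP[nb ns].
rewrite morph_cons weight_cat IH // wt_fix //.
by rewrite /weight big_cons.
Qed.

(** A run inside a single image weighs at most [L * L], and each of the potentials [sw] and [pwt] is
    at most [#|A| * (L * L)]. *)
Definition run_max := (#|A| * 2).+1 * (L * L).

(* From one level to the next, a run between [e] and [e'] grows by the run ending
   the image of [e] and the run starting the image of [e']; their weights are
   the terms that [sw] and [pwt] lose when passing to the new neighbours. *)
Lemma run_inv t d u e r e' v : C d -> pw Psi t d = u ++ e :: r ++ e' :: v ->
  G e -> G e' -> ~~ has G r -> weight wt r + (sw e + pwt e') <= run_max.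
Proof.
move=> Cd; elim: t u e r e' v => [|t IH] u e r e' v.
  move=> E0; have := congr1 size E0; rewrite size_cat /= size_cat /=; lia.
rewrite pwS => E Ge Ge' nr.
have [w1 [e1 [w2 [u2 [v2 [Ew Ee1 _ Ev]]]]]] := morph_split E.
have e1w : e1 \in pw Psi t d by rewrite Ew mem_cat mem_head orbT.
have Ge1 : G e1.
  apply: contraLR Ge => ne1; apply: nongrow_closed ne1 _.
  by rewrite Ee1 mem_cat mem_head orbT.
have Ce1 := C_pw Cd e1w Ge1.
(* Either the run and [e'] both lie in the image of [e1], and crude bounds suffice, or the run is
   the end [v2] of that image, the image of a run [r'] and the beginning [u3] of the image of the
   next growing letter [e1']. *)
case: (ltnP (size r) (size v2)) => Hr.
  have Hsr : size r <= L.
    by apply: leq_trans (Psi_le e1); rewrite Ee1 size_cat /=; apply: leq_trans (ltnW Hr) _; rewrite addnS -addSn leq_addl.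
  have H1 := tail_weight_le G e wt_le Psi_le.
  have H2 : pwt e' <= #|A| * (L * L).
    by apply: tail_weight_le => // b; rewrite size_rev.
  have H3 := weight_le r wt_le.
  have H4 : size r * L <= L * L by rewrite leq_mul2r Hsr orbT.
  rewrite /run_max mulSn mulnAC muln2 -addnn /sw; lia.
have Er : r = v2 ++ drop (size v2) r.
  rewrite -{1}(cat_take_drop (size v2) r); congr (_ ++ _).
  have := congr1 (take (size v2)) Ev.
  by rewrite takel_cat // take_size_cat.
have E2 : morph Psi w2 = drop (size v2) r ++ e' :: v.
  have := congr1 (drop (size v2)) Ev.
  by rewrite Er -catA !drop_size_cat.
have [r' [e1' [w3 [u3 [v3 [Ew2 Ee1' Er2 _]]]]]] := morph_split E2.
have e1w' : e1' \in pw Psi t d by rewrite Ew Ew2 !(mem_cat, inE) eqxx !orbT.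
have Ge1' : G e1'.
  apply: contraLR Ge' => ne1; apply: nongrow_closed ne1 _.
  by rewrite Ee1' mem_cat mem_head orbT.
have Ce1' := C_pw Cd e1w' Ge1'.
have nr' : ~~ has G r'.
  apply/hasPn => x xr; apply/negP => Gx.
  have Cx : C x by apply: (@C_pw t d x Cd _ Gx); rewrite Ew Ew2 !(mem_cat, inE) xr !orbT.
  have /hasP[z zx Gz] := C_grow Cx.
  move/hasPn: nr => /(_ z); rewrite Gz Er Er2 => /(_ _)/negP; apply=> //.
  by rewrite !mem_cat (_ : z \in morph Psi r') ?orbT //; apply/mem_morphP; exists x.
have := IH _ _ _ _ _ (etrans Ew (congr1 (fun s => w1 ++ e1 :: s) Ew2)) Ge1 Ge1' nr'.
have nv2 : ~~ has G v2 by move: nr; rewrite Er has_cat negb_or => /andP[].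
have nu3 : ~~ has G u3 by move: nr; rewrite Er Er2 !has_cat !negb_or => /and3P[].
have [[ul El] GL nT] := trailE e1 (C_grow Ce1).
have [_ EL ET] := split_unique (etrans (esym El) Ee1) GL Ge nT nv2.
have [[ur Efr] GF nF] := @trailE _ G e1' (rPsi e1') (ltac:(by rewrite has_rev C_grow)).
have Ee3 : rPsi e1' = rev v3 ++ e' :: rev u3.
  by rewrite /rPsi Ee1' rev_cat rev_cons cat_rcons.
have [_ EF EV] := split_unique (etrans (esym Efr) Ee3) GF Ge' nF (ltac:(by rewrite has_rev)).
have S1 := sw_step Ce1; have S2 := rPsi_step Ce1'.
rewrite /Tail /Last EL ET in S1; rewrite /Tail /Last EF EV weight_rev in S2.
have -> : weight wt r = weight wt v2 + (weight wt r' + weight wt u3).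
  by rewrite Er Er2 !weight_cat weight_nongrow.
move=> Hrun; apply: leq_trans Hrun.
by rewrite (addnCA (weight wt v2)) -addnA addnACA leq_add2l leq_add.
Qed.

(** If only one growing letter occurred in [Psi d], it would be [d] itself by [C_total]. The runs
    around it would be empty by the two run hypotheses with exponent 1, leaving [Psi d = [:: d]]. *)
Lemma two_growing d : C d -> exists u x v y w,
  [/\ Psi d = u ++ x :: v ++ y :: w, C x & C y].
Proof.
move=> Cd; have [[u E] Gx nv] := trailE d (C_grow Cd).
set x := last_in G d (Psi d) in E Gx; set v := trail G (Psi d) in E nv.
have Cx : C x by apply: C_closed Cd _ Gx; rewrite E mem_cat mem_head orbT.
have [Hu|nu] := boolP (has G u).
  have [[u' Eu] Gy nw] := trailE d Hu.
  exists u', (last_in G d u), (trail G u), x, v; split=> //.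
    by rewrite E {1}Eu -catA.
  apply: C_closed Cd _ Gy.
  by rewrite E mem_cat {2}Eu mem_cat mem_head !orbT.
have dx : d = x.
  have := C_total Cd Cd; rewrite E mem_cat inE => /or3P[H|/eqP//|H].
    by case/hasP: nu; exists d => //; exact: CG.
  by case/hasP: nv; exists d => //; exact: CG.
have A0 : 0 < 1 <= #|A| by rewrite /=; apply/card_gt0P; exists d.
rewrite -{1}dx in E; rewrite -pw1 in E.
have v0 := no_suffix_run Cd A0 E nv; have u0 := no_prefix_run Cd A0 E nu.
by case: (C_not_single Cd); rewrite -[LHS]pw1 E u0 v0.
Qed.

(** Since [run_inv] only treats runs enclosed by growing letters, a letter [d0] with letters of [C]
    on both sides is needed: a run at the end of an iterate of [d0] then still continues only up to
    a growing letter. *)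
Lemma inner_letter d : C d -> exists d0 x1 x2 u1 u2 v1 v2,
  [/\ C d0, C x1, C x2 & pw Psi 2 d = u1 ++ x1 :: u2 ++ d0 :: v1 ++ x2 :: v2].
Proof.
move=> Cd; have [u [x [v [y [w [E Cx Cy]]]]]] := two_growing Cd.
have [a [x1 [b [d0 [c [Ex Cx1 Cd0]]]]]] := two_growing Cx.
have [a' [x2 [b' [y2 [c' [Ey Cx2 _]]]]]] := two_growing Cy.
exists d0, x1, x2, (morph Psi u ++ a), b, (c ++ morph Psi v ++ a'), (b' ++ y2 :: c' ++ morph Psi w).
split=> //; rewrite pwS pw1 E !(morph_cat, morph_cons) Ex Ey.
by do 5 rewrite -?catA /=.
Qed.

Lemma has_grow_pw t b : C b -> has G (pw Psi t b).
Proof.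
move=> Cb; elim: t => [|t /hasP[x xb Gx]]; first by rewrite /= CG.
rewrite pwS; have Cx := C_pw Cb xb Gx; case/hasP: (C_grow Cx) => y yx Gy.
by apply/hasP; exists y => //; apply/mem_morphP; exists x.
Qed.

Lemma run_bound d : C d -> exists2 d0, C d0 &
  forall t r, infix r (pw Psi t d0) -> ~~ has G r -> size r <= run_max.
Proof.
move=> Cd; have [d0 [x1 [x2 [u1 [u2 [v1 [v2 [Cd0 Cx1 Cx2 E]]]]]]]] := inner_letter Cd.
exists d0 => // t r /infixP[a [b Er]] nr.
pose P := pw Psi t.
pose l := morph P u1 ++ P x1 ++ morph P u2 ++ a.
pose q := b ++ morph P v1 ++ P x2 ++ morph P v2.
have Et : pw Psi (t + 2) d = l ++ r ++ q.
  rewrite pwD E !(morph_cat, morph_cons) Er -/P /l /q.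
  by do 5 rewrite -?catA /=.
have Gl : has G l by rewrite !has_cat has_grow_pw ?orbT.
have Gq : has G (rev q) by rewrite has_rev !has_cat has_grow_pw ?orbT.
(* Extend [r] to the nearest growing letters on both sides; the iterates of [x1] and [x2] provide
   them. *)
have [[l1 El] Ge nl] := trailE d Gl.
have [[q1 Eq] Ge' nq] := trailE d Gq.
set e := last_in G d l in El Ge; set e' := last_in G d (rev q) in Eq Ge'.
have Eq2 : q = rev (trail G (rev q)) ++ e' :: rev q1.
  by rewrite -{1}(revK q) {1}Eq rev_cat rev_cons cat_rcons.
have nrun : ~~ has G (trail G l ++ r ++ rev (trail G (rev q))).
  by rewrite !has_cat !negb_or nl nr has_rev nq.
have Et' : pw Psi (t + 2) d = l1 ++ e :: (trail G l ++ r ++ rev (trail G (rev q))) ++ e' :: rev q1.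
  by rewrite Et {1}El {1}Eq2; do 5 rewrite -?catA /=.
move: (run_inv Cd Et' Ge Ge' nrun); rewrite !weight_cat.
suff Hr : size r <= weight wt r.
  by apply: leq_trans; apply: leq_trans Hr _; rewrite (addnCA (weight wt _)) -addnA leq_addr.
rewrite /weight; elim: (r) => [|z s IH]; rewrite ?big_nil ?big_cons //=.
by rewrite -add1n leq_add.
Qed.

End Runs.

(** * Uniform recurrence *)

(** An increasing chain of subsets of [T] has at most [#|T|] strict steps, and by the second
    hypothesis it is constant from its first repetition on. *)
Lemma chain_stable (T : finType) (F : nat -> {set T}) :
  (forall t, F t \subset F t.+1) -> (forall t, F t = F t.+1 -> F t.+1 = F t.+2) ->
  forall t, F t \subset F #|T|.
Proof.
move=> inc stab.
have mono i j : i <= j -> F i \subset F j.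
  elim: j => [|j IH]; first by rewrite leqn0 => /eqP->.
  rewrite leq_eqVlt => /orP[/eqP->|] //; rewrite ltnS => /IH H.
  exact: subset_trans H (inc j).
have [k Hk E] : exists2 k, k <= #|T| & F k = F k.+1.
  have [/existsP[k /eqP E]|] := boolP [exists k : 'I_#|T|.+1, F k == F k.+1].
    by exists k => //; rewrite -ltnS.
  rewrite negb_exists => /forallP H.
  have grow k : k <= #|T|.+1 -> k <= #|F k|.
    elim: k => // k IH Hk; apply: leq_trans (_ : #|F k|.+1 <= _); first by rewrite ltnS IH // ltnW.
    apply: proper_card; rewrite properEneq inc andbT.
    by have := H (Ordinal Hk) => /= ->.
  by have := leq_trans (grow _ (leqnn _)) (max_card _); rewrite ltnn.
have all_eq j : F (k + j) = F k /\ F (k + j).+1 = F k.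
  by elim: j => [|j [IH1 IH2]]; [rewrite addn0 -E|rewrite addnS IH2 -stab // IH1].
move=> t; case: (leqP t k) => tk; first exact: subset_trans (mono _ _ tk) (mono _ _ Hk).
have -> : F t = F k by rewrite -(subnKC (ltnW tk)); case: (all_eq (t - k)).
exact: mono.
Qed.

Lemma drop_catl (T : Type) n (a b : seq T) : n <= size a -> drop n (a ++ b) = drop n a ++ b.
Proof.
move=> H; rewrite drop_cat; case: ltnP => // H2.
have E : n = size a by lia.
by rewrite E subnn drop0 drop_size.
Qed.

(** As no image is empty, [l] consecutive letters suffice, starting with the one whose image
    contains the first letter of [u]. *)
Lemma infix_cover (A B : eqType) (f : A -> seq B) w u l :
  (forall b, 0 < size (f b)) -> size u = l -> l <= size w -> infix u (morph f w) ->
  exists v, [/\ infix v w, size v = l & infix u (morph f v)].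
Proof.
move=> f0 <- lw /infixP[a [b E]].
case: u lw E => [|x u] lw E; first by exists [::]; split=> //; exact: infix0s.
set l' := size (x :: u) in lw *.
have Ha : size a < size (morph f w) by rewrite E !size_cat /=; lia.
have [i iw /andP[H1 H2]] := morph_locate Ha.
(* The window is moved to the left when it would run over the end of [w]. *)
pose j := minn i (size w - l').
have Hj : size (morph f (take j w)) <= size a.
  by apply: leq_trans H1; apply: size_morph_take_le; exact: geq_minl.
exists (take l' (drop j w)); split; first exact: infix_take_drop.
  by rewrite size_take_min size_drop /j; lia.
have Ew : w = take j w ++ take l' (drop j w) ++ drop l' (drop j w) by rewrite !cat_take_drop.
have E3 : drop (size (morph f (take j w))) a ++ (x :: u) ++ b =
   morph f (take l' (drop j w)) ++ morph f (drop l' (drop j w)).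
  have := congr1 (drop (size (morph f (take j w)))) E.
  by rewrite drop_morph drop_catl // => <-; rewrite -morph_cat cat_take_drop.
have Hs : size (drop (size (morph f (take j w))) a ++ x :: u) <= size (morph f (take l' (drop j w))).
  case: (ltnP (size w) (i + l')) => Hi.
    have Ej : j + l' = size w by rewrite /j; lia.
    have Z : morph f (drop l' (drop j w)) = [::] by rewrite drop_drop (addnC l') Ej drop_size.
    rewrite Z cats0 in E3.
    by rewrite -E3 !size_cat /=; lia.
  have Ej : j = i by rewrite /j; lia.
  have Edrop : take l' (drop i w) = take 1 (drop i w) ++ take (size u) (drop i.+1 w).
    by rewrite -(addn1 i) (addnC i) -drop_drop -takeD.
  have Hi1 : size (morph f (take i.+1 w)) = size (morph f (take i w)) + size (morph f (take 1 (drop i w))).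
    by rewrite -(addn1 i) takeD morph_cat size_cat.
  rewrite Ej Edrop morph_cat !size_cat size_drop /=.
  have := size_morph_ge (take (size u) (drop i.+1 w)) f0.
  rewrite size_take_min size_drop; rewrite /l' /= in Hi; lia.
apply/infixP; exists (drop (size (morph f (take j w))) a).
rewrite catA in E3.
rewrite -[morph f (take _ _)](@take_size_cat _ _ _ (morph f (drop l' (drop j w))) erefl) -E3 take_cat ltnNge Hs /=.
by eexists; rewrite -catA.
Qed.

(** At the two ends of [u] an image may be cut, which costs at most [2 * K] letters; the remaining
    ones hold [r] full images. *)
Lemma infix_contains (A B : eqType) (f : A -> seq B) (w : seq A) (u : seq B) (r K : nat) :
  (forall b, size (f b) <= K) -> 0 < r -> size u = (r + 2) * K -> 0 < K -> infix u (morph f w) ->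
  exists v, [/\ infix v w, size v = r & infix (morph f v) u].
Proof.
move=> fK r0 su K0 /infixP[a [b E]].
have Ha : size a < size (morph f w) by rewrite E !size_cat su; nia.
have [i iw /andP[H1 H2]] := morph_locate Ha.
have bdle l : size (morph f (take (i + l) w)) <= size (morph f (take i w)) + l * K.
  rewrite takeD morph_cat size_cat leq_add2l.
  apply: leq_trans (size_morph_le _ fK) _.
  by rewrite leq_mul2r size_take_min geq_minl orbT.
have irw : i.+1 + r <= size w.
  rewrite leqNgt; apply/negP => H.
  have := bdle r.+1; rewrite take_oversize; last lia.
  by rewrite E !size_cat su; nia.
pose v := take r (drop i.+1 w).
exists v; split; first exact: infix_take_drop.
  by rewrite size_take_min size_drop; lia.
have H3 : size (morph f (take i.+1 w)) + size (morph f v) <= size a + size u.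
  have := bdle r.+1; rewrite -addSnnS takeD morph_cat size_cat -/v su; nia.
have Ev : morph f v = take (size (morph f v)) (drop (size (morph f (take i.+1 w))) (morph f w)).
  rewrite drop_morph -(cat_take_drop r (drop i.+1 w)) morph_cat -/v.
  by rewrite take_size_cat.
have E2 : drop (size (morph f (take i.+1 w))) (morph f w) =
   drop (size (morph f (take i.+1 w)) - size a) u ++ b.
  rewrite E drop_cat ltnNge (ltnW H2) /= drop_catl //; lia.
rewrite Ev E2 takel_cat; last by rewrite size_drop; lia.
exact: infix_take_drop.
Qed.

Section Constants.
Variables N L : nat.
(* For an alphabet of [N] letters with images of length at most [L]: factors of
   length [b_run] contain a growing letter; the word of level [b_sat] contains all
   factors of length [b_run.+1] and is contained in all factors of length [b_rec];
   factors of length [b_win] determine the contents following the marks in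
   their first block; [b_data] counts the possible patterns of these contents;
   [2 * b_step] more levels multiply the lengths by more than the ratio of the
   largest to the smallest distance between marks. *)
Definition b_run := ((N * 2).+1 * (L * L)).+1.
Definition b_sat := b_run.+1 + N ^ b_run.+1.
Definition b_rec := (b_run + 2) * L ^ b_sat.+1.
Definition b_win := (b_run * ((b_rec.+1 + L ^ b_sat) * (L * L))).+1.
Definition b_data := (N ^ b_win * (L * L)).+1 ^ (N ^ b_win * (L * L)).
Definition b_step := b_rec.+1 * (L * L).
Definition b_period := L ^ (b_step * b_data * 2 + 2).
End Constants.

Section Recur.
Variables (A : finType) (Psi : A -> seq A) (L : nat) (G C : pred A).
Hypothesis Psi_gt0 : forall b, 0 < size (Psi b).
Hypothesis Psi_le : forall b, size (Psi b) <= L.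
Hypothesis nongrow_closed : forall b x, ~~ G b -> x \in Psi b -> ~~ G x.
Hypothesis C_total : forall b x, C b -> C x -> x \in Psi b.
Hypothesis CG : forall b, C b -> G b.
Hypothesis C_closed : forall b x, C b -> x \in Psi b -> G x -> C x.
Hypothesis C_not_single : forall b, C b -> Psi b <> [:: b].
Variable d0 : A.
Hypothesis Cd0 : C d0.
Variable r0 : nat.
Hypothesis runs : forall t r, infix r (pw Psi t d0) -> ~~ has G r -> size r < r0.

Lemma pw_self_infix t : infix (pw Psi t d0) (pw Psi t.+1 d0).
Proof.
rewrite pwSr; case/splitPr: (C_total Cd0 Cd0) => u v.
by rewrite morph_cat morph_cons; apply/infixP; eexists; eexists.
Qed.

Lemma size_pw_ge t : t < size (pw Psi t d0).
Proof.
elim: t => // t IH; rewrite pwSr.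
have H2 : 1 < size (Psi d0).
  rewrite ltnNge; apply/negP => H; have := C_total Cd0 Cd0; have := C_not_single Cd0.
  by case: (Psi d0) H => [|a [|b s]] //= _; rewrite inE => H /eqP H2; case: H; rewrite H2.
case/splitPr: (C_total Cd0 Cd0) H2 => u v; rewrite morph_cat morph_cons !size_cat /=.
have pg b : 0 < size (pw Psi t b) by apply: pw_gt0.
move: (size_morph_ge u pg) (size_morph_ge v pg) IH; rewrite -/(pw Psi t).
move: (size (morph _ u)) (size (morph _ v)) (size (pw _ _ _)) (size u) (size v) => a b c e f.
by clear; lia.
Qed.

Lemma pw_mono t k : infix (pw Psi t d0) (pw Psi (t + k) d0).
Proof.
elim: k => [|k IH]; first by rewrite addn0 infix_refl.
by rewrite addnS; apply: infix_trans IH _; exact: pw_self_infix.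
Qed.

(** The sets of factors of length [l] increase with the level. By [infix_cover] those of one level
    determine those of the next, so [chain_stable] applies to sets of [l]-tuples; starting at level
    [l] ensures that the word has length at least [l]. *)
Lemma factors_sat l t u : size u = l -> infix u (pw Psi t d0) ->
  infix u (pw Psi (l + #|A| ^ l) d0).
Proof.
move=> su Hu.
pose F t := [set W : l.-tuple A | infix W (pw Psi (l + t) d0)].
have inc t' : F t' \subset F t'.+1.
  apply/subsetP => W; rewrite !inE => H; apply: infix_trans H _.
  by rewrite addnS; exact: pw_self_infix.
have stab t' : F t' = F t'.+1 -> F t'.+1 = F t'.+2.
  move=> E; apply/eqP; rewrite eqEsubset inc /=; apply/subsetP => W; rewrite !inE => H.
  rewrite addnS pwS in H.
  have [|v [v1 v2 v3]] := infix_cover Psi_gt0 (size_tuple W) _ H.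
    by apply: leq_trans (ltnW (size_pw_ge _)); exact: leq_addr.
  have vt : size v == l by rewrite v2.
  have : Tuple vt \in F t'.+1 by rewrite inE.
  rewrite -E inE => /= H4; apply: infix_trans v3 _.
  by rewrite addnS pwS; exact: infix_morph.
have ut : size u == l by rewrite su.
have : Tuple ut \in F t.
  by rewrite inE /=; apply: infix_trans Hu _; rewrite addnC; exact: pw_mono.
by move/(subsetP (chain_stable inc stab t)); rewrite inE card_tuple.
Qed.

Lemma window_grow t u : infix u (pw Psi t d0) -> size u = r0 -> exists2 x, x \in u & C x.
Proof.
move=> Hu su; have [/hasP[x xu Gx]|nu] := boolP (has G u).
  exists x => //; apply: (@C_pw _ Psi G C nongrow_closed C_closed t d0) => //.
  by case/infixP: Hu => a [b ->]; rewrite !mem_cat xu !orbT.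
by have := runs Hu nu; rewrite su ltnn.
Qed.

(** By [infix_contains], [u] contains the images under the power [s.+1] of [r0] consecutive letters.
    One of them lies in [C], and [d0] occurs in its image, so level [s] of [d0] occurs in its level
    [s.+1]. *)
Lemma window_recur s t u : s < t -> infix u (pw Psi t d0) -> size u = (r0 + 2) * L ^ s.+1 ->
  infix (pw Psi s d0) u.
Proof.
move=> st; rewrite -(subnKC st) pwD => Hu su.
have L0 : 0 < L by apply: leq_trans (Psi_le d0); exact: Psi_gt0.
have [||v [v1 v2 v3]] := infix_contains (fun b => size_pw_le s.+1 b Psi_le) _ su _ Hu.
- exact: (runs (infix0s (pw Psi 0 d0)) isT).
- by rewrite expn_gt0 L0.
have [x xv Cx] := window_grow v1 v2.
apply: infix_trans v3.
case/splitPr: xv => a b; rewrite morph_cat morph_cons.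
apply: infix_trans (_ : infix (pw Psi s.+1 x) _); last by apply/infixP; eexists; eexists.
rewrite pwSr; case/splitPr: (C_total Cx Cd0) => a' b'.
by rewrite morph_cat morph_cons; apply/infixP; eexists; eexists.
Qed.
End Recur.

(** * Period bound from a class of growing letters *)

Section Bound.
Variables (A : finType) (B : eqType) (x0 : B) (X : nat -> B) (p : nat).
Hypothesis Xp : min_period X p.
Variables (Psi : A -> seq A) (g : A -> seq B) (L : nat) (G C : pred A).
Hypothesis Psi_gt0 : forall b, 0 < size (Psi b).
Hypothesis Psi_le : forall b, size (Psi b) <= L.
Hypothesis g_gt0 : forall b, 0 < size (g b).
Hypothesis g_le : forall b, size (g b) <= L.
Hypothesis g_fix : forall b, ~~ G b -> morph g (Psi b) = g b.
Hypothesis nongrow_closed : forall b x, ~~ G b -> x \in Psi b -> ~~ G x.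
Hypothesis Psi_trans : forall b x z, x \in Psi b -> z \in Psi x -> z \in Psi b.
Hypothesis C_total : forall b x, C b -> C x -> x \in Psi b.
Hypothesis CG : forall b, C b -> G b.
Hypothesis C_closed : forall b x, C b -> x \in Psi b -> G x -> C x.
Hypothesis C_not_single : forall b, C b -> Psi b <> [:: b].
Variable d : A.
Hypothesis Cd : C d.
Hypothesis occ : forall k x, C x -> exists s,
  morph g (pw Psi k x) = slice X s (size (morph g (pw Psi k x))).

Let L_gt0 : 0 < L. Proof. by apply: leq_trans (Psi_le d); exact: Psi_gt0. Qed.

Lemma size_gpw k b : size (morph g (pw Psi k b)) <= L ^ k.+1.
Proof.
rewrite expnSr; apply: leq_trans (size_morph_le _ g_le) _.
by rewrite leq_mul2r size_pw_le ?orbT.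
Qed.

Lemma mem_pw k b x : x \in pw Psi k.+1 b -> x \in Psi b.
Proof.
elim: k x => [|k IH] x; first by rewrite pw1.
by rewrite pwS => /mem_morphP[z /IH H]; exact: Psi_trans.
Qed.

Lemma gpw_sub k b x : x \in Psi b -> size (morph g (pw Psi k x)) <= size (morph g (pw Psi k.+1 b)).
Proof.
by move=> H; rewrite pwSr morph_comp; apply: (size_morph_mem (fun x => morph g (pw Psi k x))).
Qed.

Lemma gpw_gt0 k b : 0 < size (morph g (pw Psi k b)).
Proof. by apply: leq_trans (size_morph_ge _ g_gt0); exact: pw_gt0. Qed.

Lemma gpw_comp k t b : morph g (pw Psi (k + t) b) = morph (fun b => morph g (pw Psi k b)) (pw Psi t b).
Proof. by rewrite pwD morph_comp. Qed.

(** The letters of the second power at [b] all occur in [Psi d0] by transitivity, so none has a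
    longer level-[k] image than [d0] has on level [k.+1]. This is the comparison constant [L * L]
    between images on one level. *)
Lemma gpw_le2 k d0 b : b \in Psi d0 ->
  size (morph g (pw Psi k.+2 b)) <= (L * L) * size (morph g (pw Psi k.+1 d0)).
Proof.
move=> bd; rewrite -addn2 gpw_comp.
apply: leq_trans (_ : size (pw Psi 2 b) * size (morph g (pw Psi k.+1 d0)) <= _).
  apply: size_morph_le_in => x xb; apply: gpw_sub.
  exact: Psi_trans bd (mem_pw xb).
by rewrite leq_mul2r (_ : L * L = L ^ 2) ?mulnn // size_pw_le ?orbT.
Qed.

Section Recurrent.
Hypothesis no_suffix_run : forall x k u v, C x -> 0 < k <= #|A| ->
  pw Psi k x = u ++ x :: v -> ~~ has G v -> v = [::].
Hypothesis no_prefix_run : forall x k u v, C x -> 0 < k <= #|A| ->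
  pw Psi k x = u ++ x :: v -> ~~ has G u -> u = [::].

Lemma recurrent_bound : p <= b_period #|A| L.
Proof.
have [d0 Cd0 runs] := run_bound Psi_gt0 Psi_le g_le g_gt0
  (fun b nb => etrans (weight_morph _ _) (congr1 size (g_fix nb)))
  nongrow_closed C_total CG C_closed C_not_single no_suffix_run no_prefix_run Cd.
set N := #|A|.
have {}runs t r : infix r (pw Psi t d0) -> ~~ has G r -> size r < b_run N L.
  by move=> H1 H2; rewrite ltnS; exact: runs H1 H2.
pose Gs k := size (morph g (pw Psi k d0)).
pose s := b_sat N L.
pose y := pw Psi s d0.
pose q := b_step N L.
pose J := (b_data N L).+1.
(* Levels are taken [2 * q] apart, since lengths double every two levels and [2 ^ q > q]. The length
   scale [lam j] uses one level less than [gl j]: the level [k.+1] of a letter of [C] contains level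
   [k] of [d0], and [gpw_le2] gives the upper bound. *)
pose gl j b := morph g (pw Psi (q * j * 2).+2 b).
pose lam j := Gs (q * j * 2).+1.
(* If one of the first [J] levels exceeds [p], its length bounds [p]. Otherwise all of them
   contradict [levels_bound], as [J] is one more than the number of possible data. *)
have [[j jJ lp]|all_le] : (exists2 j, j < J & p < lam j) \/ forall j, j < J -> lam j <= p.
  have [/existsP[j H]|] := boolP [exists j : 'I_J, p < lam j]; first by left; exists j.
  by rewrite negb_exists => /forallP H; right=> j jJ; have := H (Ordinal jJ); rewrite -leqNgt.
  apply: leq_trans (ltnW lp) _; apply: leq_trans (size_gpw _ _) _.
  rewrite /b_period leq_pexp2l // -/q addn2 !ltnS leq_mul2r /=.
  by rewrite leq_mul2l -ltnS jJ orbT.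
suff : J <= b_data N L by rewrite ltnn.
pose K := (2 * p + 4) * ((b_rec N L).+1 * (L * L)).
(* Level [t] has more than [t] letters, which gives [Y_long]; the summand [s.+1] puts it above level
   [s], as [window_recur] requires. *)
pose t := (b_win N L + b_run N L * K) + s.+1.
pose Y := pw Psi t d0.
have reach b : b \in Y -> b \in Psi d0 by rewrite /Y /t addnS => /mem_pw.
(* Two letters of [C] occur in [Psi d0], and [d0] occurs in the image of each. *)
have double k : 2 * Gs k <= Gs k.+2.
  have [u [x [v [z [w [E Cx Cz]]]]]] := two_growing C_total CG C_closed C_not_single
    no_suffix_run no_prefix_run Cd0.
  rewrite /Gs pwSr morph_comp E !(morph_cat, morph_cons) !size_cat.
  have Hx := gpw_sub k (C_total Cx Cd0); have Hz := gpw_sub k (C_total Cz Cd0).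
  rewrite mul2n -addnn; apply: leq_trans (leq_add Hx Hz) _.
  apply: leq_trans (leq_addl _ _); rewrite leq_add2l; apply: leq_trans (leq_addl _ _).
  exact: leq_addr.
have Gs_pow k i : 2 ^ i * Gs k <= Gs (k + i * 2).
  elim: i => [|i IH]; first by rewrite mul1n addn0.
  rewrite mulSn addnCA !addSn add0n; apply: leq_trans (double _).
  by rewrite expnS -mulnA leq_mul2l IH.
have ex j : exists o, morph (gl j) Y == slice X o (size (morph (gl j) Y)).
  have [o Eo] := occ ((q * j * 2).+2 + t) Cd0.
  by exists o; apply/eqP; rewrite /gl /Y -gpw_comp.
pose sigma j := xchoose (ex j).
have Cw w : infix w Y -> size w = b_run N L -> exists2 x, x \in w & C x.
  exact: (window_grow nongrow_closed C_closed Cd0 runs).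
apply: (@levels_bound A B x0 X p Xp Y y (b_run N L) (b_rec N L) (L * L) (L ^ s) _ _ _ _ _ J gl lam sigma).
- by rewrite muln_gt0 L_gt0.
- exact: size_pw_le.
- apply: leq_trans (ltnW (size_pw_ge Psi_gt0 C_total C_not_single Cd0 _)).
  exact: leq_addr.
- by move=> w Hw sw; apply: (factors_sat Psi_gt0 C_total C_not_single Cd0 sw Hw).
- move=> w Hw sw; apply: (window_recur Psi_gt0 Psi_le nongrow_closed C_total C_closed Cd0 runs _ Hw sw).
  by rewrite /t addnS ltnS leq_addl.
- by move=> j _; exact: gpw_gt0.
- exact: all_le.
- by move=> j _ b /reach bd; exact: gpw_le2.
- move=> j _ w Hw sw; have [x xw Cx] := Cw w Hw sw.
  by apply: leq_trans (gpw_sub _ (C_total Cx Cd0)) (size_morph_mem (gl j) xw).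
- move=> j _ i Hi; have /eqP E := xchooseP (ex j).
  by rewrite -/(sigma j) in E; rewrite E nth_mkseq.
- move=> i j ij _; have := Gs_pow (q * i * 2).+1 (q * (j - i)).
  rewrite addSn -mulnDl -mulnDr subnKC ?(ltnW ij) // -/(lam i) -/(lam j).
  apply: leq_trans; rewrite ltn_mul2r gpw_gt0 /=.
  apply: leq_trans (ltn_expl q (ltnSn 1)) _; rewrite leq_pexp2l //.
  by rewrite leq_pmulr // subn_gt0.
Qed.
End Recurrent.

Lemma morph_gpw k s : ~~ has G s -> morph g (morph (pw Psi k) s) = morph g s.
Proof.
move=> /hasPn ns; rewrite morph_comp; apply: eq_in_morph => b /ns.
elim: k b => [|k IH] b nb; first by rewrite pw0 morph1.
rewrite pwSr morph_comp -[RHS]g_fix //; apply: eq_in_morph => x xb.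
exact/IH/nongrow_closed/xb.
Qed.

Lemma flatten_nseqS (T : Type) j (v : seq T) : flatten (nseq j.+1 v) = flatten (nseq j v) ++ v.
Proof. by rewrite -addn1 nseqD flatten_cat /= cats0. Qed.

(** Repeating the power [k] puts one more copy of the run behind [x] each time, and its [g]-image
    does not change. So arbitrarily high powers of [morph g v] occur in [X], and [power_min_period]
    applies. *)
Lemma suffix_run_bound x k u v : C x -> k <= #|A| -> pw Psi k x = u ++ x :: v ->
  ~~ has G v -> 0 < size v -> p <= L ^ #|A|.+1.
Proof.
move=> Cx kA E nv v0.
have g0 : 0 < size (morph g v) by apply: leq_trans v0 (size_morph_ge _ g_gt0).
have H j : exists w, morph g (pw Psi (j * k) x) = w ++ flatten (nseq j (morph g v)).
  elim: j => [|j [w IH]]; first by exists (g x); rewrite mul0n pw0 morph1 cats0.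
  rewrite mulSn addnC pwD E !(morph_cat, morph_cons) IH (morph_gpw _ nv) flatten_nseqS.
  by eexists; rewrite !catA.
have [w Ew] := H p.+1; have [s Es] := occ (p.+1 * k) Cx.
apply: leq_trans (power_min_period (v := morph g v) (s := s) (l := size (morph g (pw Psi (p.+1 * k) x))) x0 Xp g0 _) _.
  by rewrite -Es Ew; apply/infixP; exists w, [::]; rewrite cats0.
apply: leq_trans (_ : size (morph g (pw Psi k x)) <= _).
  by rewrite E !(morph_cat, morph_cons) !size_cat addnA leq_addl.
by apply: leq_trans (size_gpw _ _) _; rewrite leq_pexp2l.
Qed.

Lemma prefix_run_bound x k u v : C x -> k <= #|A| -> pw Psi k x = u ++ x :: v ->
  ~~ has G u -> 0 < size u -> p <= L ^ #|A|.+1.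
Proof.
move=> Cx kA E nu u0.
have g0 : 0 < size (morph g u) by apply: leq_trans u0 (size_morph_ge _ g_gt0).
have H j : exists w, morph g (pw Psi (j * k) x) = flatten (nseq j (morph g u)) ++ w.
  elim: j => [|j [w IH]]; first by exists (g x); rewrite mul0n pw0 morph1.
  rewrite mulSn addnC pwD E !(morph_cat, morph_cons) IH (morph_gpw _ nu) /=.
  by eexists; rewrite -!catA.
have [w Ew] := H p.+1; have [s Es] := occ (p.+1 * k) Cx.
apply: leq_trans (power_min_period (v := morph g u) (s := s) (l := size (morph g (pw Psi (p.+1 * k) x))) x0 Xp g0 _) _.
  by rewrite -Es Ew; apply/infixP; exists [::], w.
apply: leq_trans (_ : size (morph g (pw Psi k x)) <= _).
  by rewrite E !(morph_cat, morph_cons) !size_cat leq_addr.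
by apply: leq_trans (size_gpw _ _) _; rewrite leq_pexp2l.
Qed.

Lemma class_bound : p <= b_period #|A| L + L ^ #|A|.+1.
Proof.
case: (leqP p (L ^ #|A|.+1)) => H; first exact: leq_trans H (leq_addl _ _).
apply: leq_trans (leq_addr _ _); apply: recurrent_bound => x k u v Cx /andP[_ kA] E nv.
- case: v E nv => // a v E nv; move: H; rewrite ltnNge => /negP[].
  exact: suffix_run_bound Cx kA E nv _.
- case: u E nv => // a u E nv; move: H; rewrite ltnNge => /negP[].
  exact: prefix_run_bound Cx kA E nv _.
Qed.
End Bound.

(** * Growing letters of an idempotent morphism *)

Section Grow.
Variables (A : finType) (Psi : A -> seq A).
Hypothesis idem : forall b x, (x \in morph Psi (Psi b)) = (x \in Psi b).
Definition expands x := (x \in Psi x) && (Psi x != [:: x]).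
(** For a nonerasing [Psi] these are the letters with unbounded iterates; by idempotence of
    occurrence one application of [Psi] already shows every letter that is ever reached. *)
Definition growing b := [exists x, (x \in Psi b) && expands x].

Lemma idem_trans b x z : x \in Psi b -> z \in Psi x -> z \in Psi b.
Proof. by move=> xb zx; rewrite -idem; apply/mem_morphP; exists x. Qed.

Lemma growingP b : reflect (exists2 x, x \in Psi b & expands x) (growing b).
Proof. by apply: (iffP existsP) => [[x /andP[]]|[x H1 H2]]; exists x => //; rewrite H1. Qed.

Lemma nongrowing_closed b x : ~~ growing b -> x \in Psi b -> ~~ growing x.
Proof.
move=> nb xb; apply: contra nb => /growingP[z zx ez].
by apply/growingP; exists z => //; exact: idem_trans xb zx.
Qed.

(** Among the letters of [Psi b] that produce [x], [terminal_class] yields one, [z], that occurs in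
    its own image. As [b] is nongrowing, [z] does not expand, so [Psi z = [:: z]] and [x = z]. *)
Lemma nongrowing_fixed b x : ~~ growing b -> x \in Psi b -> Psi x = [:: x].
Proof.
move=> nb xb.
pose S z := (z \in Psi b) && (x \in Psi z).
have step z : z \in Psi b -> x \in Psi z -> exists2 z', S z' & z' \in Psi z.
  move=> zb; rewrite -idem => /mem_morphP[z' z1 z2].
  by exists z' => //; rewrite /S z2 (idem_trans zb z1).
have [z0 S0] : exists z, S z.
  by have := xb; rewrite -idem => /mem_morphP[z zb xz]; exists z; rewrite /S zb.
have tr : transitive (fun a b => b \in Psi a) by move=> y x' z; exact: idem_trans.
have [c /andP[cb xc] Hc] := @terminal_class A (fun a b => b \in Psi a) S z0 tr S0
  (fun z Hz => let: conj h1 h2 := andP Hz in step z h1 h2).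
have [z /andP[zb xz] zc] := step c cb xc.
have zz : z \in Psi z by apply: Hc => //; rewrite /S zb.
have Ez : Psi z = [:: z].
  apply/eqP; apply: contraNT nb => ne; apply/growingP; exists z => //.
  by rewrite /expands zz ne.
by have := xz; rewrite Ez inE => /eqP->.
Qed.

Variables (B : eqType) (x0 : B) (X : nat -> B) (p : nat).
Hypothesis Xp : min_period X p.
Variables (g : A -> seq B) (L : nat).
Hypothesis Psi_gt0 : forall b, 0 < size (Psi b).
Hypothesis Psi_le : forall b, size (Psi b) <= L.
Hypothesis g_gt0 : forall b, 0 < size (g b).
Hypothesis g_le : forall b, size (g b) <= L.
Hypothesis g_fix : forall b, ~~ growing b -> morph g (Psi b) = g b.

Theorem growing_bound b0 : growing b0 ->
  (forall k x, x \in Psi b0 -> exists s,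
    morph g (pw Psi k x) = slice X s (size (morph g (pw Psi k x)))) ->
  p <= b_period #|A| L + L ^ #|A|.+1.
Proof.
move=> Gb0 occ.
pose S z := growing z && (z \in Psi b0).
have step z : S z -> exists2 z', S z' & z' \in Psi z.
  move=> /andP[/growingP[x xz ex] zb]; exists x => //.
  rewrite /S (idem_trans zb xz) andbT; apply/growingP; exists x => //.
  by case/andP: ex.
have tr : transitive (fun a b => b \in Psi a) by move=> y x' z; exact: idem_trans.
have [a Sa] : exists a, S a.
  case/growingP: Gb0 => x xb ex; exists x; rewrite /S xb andbT.
  by apply/growingP; exists x => //; case/andP: ex.
have [c Sc Hc] := @terminal_class A (fun a b => b \in Psi a) S a tr Sa step.
(* The class consists of the growing letters in the image of [c]; [Hc] makes the occurrence relation
   total on it. *)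
pose C z := S z && (z \in Psi c).
have [d Sd dc] := step c Sc.
have Ctot b x : C b -> C x -> x \in Psi b by move=> /andP[? ?] /andP[? ?]; exact: Hc.
have CG b : C b -> growing b by case/andP=> /andP[].
apply: (fun H1 H2 H3 H4 H5 H6 H7 H8 H9 H10 H11 => @class_bound A B x0 X p Xp Psi g L growing C H1 H2 H3 H4 H5 H6 H7 H8 H9 H10 H11 d) => //.
- exact: nongrowing_closed.
- exact: idem_trans.
- move=> b x /andP[/andP[_ bb] bc] xb Gx.
  by rewrite /C /S Gx (idem_trans bb xb) (idem_trans bc xb).
- move=> b Cb E; have /growingP[x] := CG _ Cb.
  by rewrite E inE => /eqP -> /andP[_]; rewrite E eqxx.
- by rewrite /C Sd.
- by move=> k x /andP[/andP[_ xb] _]; exact: occ.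
Qed.
End Grow.

(** * Reduction to nonerasing idempotent morphisms *)

(** The factorial of [#|T|] is at least [#|T|], hence past the preperiod, and a multiple of the
    cycle length. *)
Lemma iter_fact (T : finType) (f : T -> T) x :
  iter (#|T|`! + #|T|`!) f x = iter #|T|`! f x.
Proof.
have [k /andP[k0 kT] E] := iter_cycle f x.
have FT : #|T| <= #|T|`!.
  by case: #|T| => // t; rewrite factS leq_pmulr // fact_gt0.
have EM m : iter (m * k) f (iter #|T| f x) = iter #|T| f x.
  by elim: m => // m IH; rewrite mulSn iterD IH.
have /dvdnP[m Em] : k %| #|T|`! by rewrite dvdn_fact ?k0.
rewrite -[in X in _ + X](subnK FT) addnA iterD (addnC _ (_ - _)) iterD Em EM -Em.
by rewrite -iterD subnK.
Qed.

Section MemIdem.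
Variables (A : finType) (f : A -> seq A).
(* [(2 ^ n) ^ n] is the number of maps from letters to sets of letters. *)
Definition idem_exp (n : nat) := ((2 ^ n) ^ n)`!.

(** The sets of letters occurring in the powers of [f], for all starting letters at once, are the
    iterates of one map on a finite type, to which [iter_fact] applies. *)
Lemma pw_mem_idem b x :
  (x \in pw f (idem_exp #|A| + idem_exp #|A|) b) = (x \in pw f (idem_exp #|A|) b).
Proof.
pose R0 : {ffun A -> {set A}} := [ffun b => [set b]].
pose F (R : {ffun A -> {set A}}) := [ffun b => [set x | [exists z in R b, x \in f z]]].
have mem k : (x \in pw f k b) = (x \in iter k F R0 b).
  elim: k x => [|k IH] x'; first by rewrite pw0 inE ffunE inE.
  rewrite pwS iterS ffunE inE; apply/mem_morphP/exists_inP => -[z z1 z2]; exists z => //.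
    by rewrite -IH.
  by rewrite IH.
have <- : #|{: {ffun A -> {set A}}}|`! = idem_exp #|A|.
  rewrite card_ffun /idem_exp; congr ((_ ^ _)`!).
  transitivity #|powerset [set: A]|; first by rewrite powersetT cardsT.
  by rewrite card_powerset cardsT.
by rewrite !mem iter_fact.
Qed.
End MemIdem.

Section Reduce.
Variables (A : finType) (B : eqType) (x0 : B) (psi : A -> seq A) (h : A -> seq B).
Hypothesis idem : forall b x, (x \in morph psi (psi b)) = (x \in psi b).

Definition visible b := 0 < size (morph h (psi b)).
(* Letters with eventually empty image are made inert, so that the resulting
   morphisms are nonerasing. *)
Definition Psi b := if visible b then filter visible (psi b) else [:: b].
(** An invisible letter may itself have a nonempty image under [h]. After two applications of [psi],
    the identity [gimage_fix] only involves images of letters under [h] after [psi], to which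
    invisible letters contribute nothing. *)
Definition image2 b := morph h (morph psi (psi b)).
Definition gimage b := if visible b then image2 b else [:: x0].

Lemma size_morph_gt0 (T : eqType) (f : T -> seq B) s :
  (0 < size (morph f s)) = has (fun x => 0 < size (f x)) s.
Proof. by elim: s => //= x s IH; rewrite morph_cons size_cat addn_gt0 IH. Qed.

Lemma visible_up b x : x \in psi b -> visible x -> visible b.
Proof.
rewrite /visible !size_morph_gt0 => xb /hasP[z zx hz]; apply/hasP; exists z => //.
by rewrite -idem; apply/mem_morphP; exists x.
Qed.

Lemma visible_down b : visible b -> has visible (psi b).
Proof.
rewrite {1}/visible size_morph_gt0 => /hasP[z]; rewrite -idem => /mem_morphP[x xb zx] hz.
by apply/hasP; exists x => //; rewrite /visible size_morph_gt0; apply/hasP; exists z.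
Qed.

Lemma morph_visible (T : Type) (f : A -> seq T) s : (forall b, ~~ visible b -> f b = [::]) ->
  morph f (filter visible s) = morph f s.
Proof.
move=> H; elim: s => //= b s IH; rewrite morph_cons -IH.
by case: ifP => // /negbT /H ->.
Qed.

Lemma invisible1 b : ~~ visible b -> morph h (psi b) = [::].
Proof. by rewrite /visible -leqNgt leqn0 size_eq0 => /eqP. Qed.

Lemma invisible2 b : ~~ visible b -> image2 b = [::].
Proof.
move=> nb; apply/eqP; rewrite -size_eq0 -leqn0 leqNgt; apply: contra nb.
rewrite /visible /image2 !size_morph_gt0 => /hasP[z zb hz]; apply/hasP; exists z => //.
by rewrite -idem.
Qed.

Lemma Psi_gt0 b : 0 < size (Psi b).
Proof.
rewrite /Psi; case: ifP => // /visible_down; rewrite has_filter.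
by case: (filter _ _).
Qed.

Lemma gimage_gt0 b : 0 < size (gimage b).
Proof.
rewrite /gimage; case: ifP => //.
rewrite /visible /image2 !size_morph_gt0 => /hasP[z zb hz]; apply/hasP; exists z => //.
by rewrite idem.
Qed.

Lemma Psi_idem b x : (x \in morph Psi (Psi b)) = (x \in Psi b).
Proof.
case vb: (visible b); last by rewrite /Psi vb morph1 /= vb.
have -> : (x \in Psi b) = visible x && (x \in psi b) by rewrite /Psi vb mem_filter.
rewrite -idem.
apply/mem_morphP/andP => [[z]|[vx /mem_morphP[z zb xz]]].
  rewrite /Psi vb mem_filter => /andP[vz zb]; rewrite vz mem_filter => /andP[vx xz].
  by split=> //; apply/mem_morphP; exists z.
have vz := visible_up xz vx.
by exists z; rewrite /Psi ?vb ?vz mem_filter ?vz ?vx.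
Qed.

(** If [b] is nongrowing, each visible letter [x] of [psi b] is fixed by [Psi], so [x] is the only
    visible letter of [psi x]; one more application of [psi] does not change its image under [h]
    after [psi]. *)
Lemma gimage_fix b : ~~ growing Psi b -> morph gimage (Psi b) = gimage b.
Proof.
move=> nb; case vb: (visible b); last by rewrite /Psi vb morph1.
have -> : morph gimage (Psi b) = morph image2 (psi b).
  rewrite -(morph_visible _ invisible2) /Psi vb.
  by apply: eq_in_morph => x; rewrite mem_filter /gimage => /andP[->].
rewrite /gimage vb {2}/image2 [RHS]morph_comp; apply: eq_in_morph => x xb.
rewrite /image2 morph_comp.
case vx: (visible x); last by rewrite invisible1 ?vx // -morph_comp -/(image2 x) invisible2 ?vx.
have xPb : x \in Psi b by rewrite /Psi vb mem_filter vx.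
have := nongrowing_fixed Psi_idem nb xPb; rewrite {1}/Psi vx => E.
by rewrite -(morph_visible _ invisible1) E morph1.
Qed.

Lemma filter_pw k b : visible b -> filter visible (pw psi k b) = pw Psi k b.
Proof.
move=> vb; elim: k => [|k IH]; first by rewrite /= vb.
rewrite !pwS -IH; elim: (pw psi k b) => //= x s IHs.
rewrite morph_cons filter_cat IHs; case: ifP => vx; first by rewrite morph_cons /Psi vx.
suff -> : filter visible (psi x) = [::] by [].
by apply/eqP; rewrite -[_ == _]negbK -has_filter; apply/hasPn => z zx; apply: contraFN vx; exact: visible_up.
Qed.

Lemma gimage_pw k b : visible b -> morph gimage (pw Psi k b) = morph h (pw psi k.+2 b).
Proof.
move=> vb; rewrite -filter_pw // !pwS !morph_comp.
have -> : morph (fun x => morph (fun x => morph h (psi x)) (psi x)) (pw psi k b) = morph image2 (pw psi k b).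
  by apply: eq_morph => x; rewrite /image2 morph_comp.
rewrite -(morph_visible (pw psi k b) invisible2); apply: eq_in_morph => x.
by rewrite mem_filter /gimage => /andP[->].
Qed.
End Reduce.

(** * The bound on the period *)

Definition ev_period (B : Type) (U : nat -> B) (p : nat) : Prop :=
  0 < p /\ exists N, forall i, N <= i -> U (i + p) = U i.

Lemma least_ev_period (B : Type) (U : nat -> B) p : ev_period U p ->
  exists2 q, ev_period U q & forall r, ev_period U r -> q <= r.
Proof.
elim/ltn_ind: p => p IH Hp.
(* Excluded middle, as eventual periods are not yet known to be decidable; it enters the correctness
   argument only, not the program. *)
have [[q [qp Hq]]|H] := classic (exists q, q < p /\ ev_period U q); first exact: IH qp Hq.
exists p => // r Hr; rewrite leqNgt; apply/negP => rp; apply: H; by exists r.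
Qed.

(** With [psi] the power [idem_exp n], this bounds the images under [psi] and those under [h] after
    two applications of [psi]. *)
Definition idem_len (n L : nat) := L ^ (idem_exp n * 2).+1.
(** The first summand serves the case without visible growing letters, the other one the growing
    case. *)
Definition period_bound (n L : nat) :=
  L ^ idem_exp n * idem_len n L + (b_period n (idem_len n L) + idem_len n L ^ n.+1).

Section PeriodBound.
Variables (A : finType) (B : eqType) (phi : A -> seq A) (h : A -> seq B) (a : A) (v : seq A).
Variable L : nat.
Hypothesis phi_a : phi a = a :: v.
Hypothesis phi_le : forall b, size (phi b) <= L.
Hypothesis h_le : forall b, size (h b) <= L.
Variable U : nat -> B.
Let word k := morph h (pw phi k a).
Hypothesis U_word : forall k, mkseq U (size (word k)) = word k.
Hypothesis word_inf : forall N, exists k, N < size (word k).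

Let x0 := U 0.
Let M := idem_exp #|A|.
Let psi := pw phi M.
Let Lam := idem_len #|A| L.

Let L_gt0 : 0 < L. Proof. by apply: leq_trans (phi_le a); rewrite phi_a. Qed.
Let M_gt0 : 0 < M. Proof. exact: fact_gt0. Qed.

Let idem b x : (x \in morph psi (psi b)) = (x \in psi b).
Proof. by rewrite /psi -pwD pw_mem_idem. Qed.

Lemma pw_mem m b x : (x \in pw psi m.+1 b) = (x \in psi b).
Proof.
elim: m x => [|m IH] x; first by rewrite pw1.
rewrite pwS -[RHS]idem; apply/mem_morphP/mem_morphP => -[t t1 t2]; exists t => //.
  by rewrite -IH.
by rewrite IH.
Qed.

Let P := Psi psi h.
Let g := gimage x0 psi h.

Lemma psi_le b : size (psi b) <= L ^ M.
Proof. exact: size_pw_le. Qed.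

Lemma Lam_ge : L ^ M <= Lam.
Proof. by rewrite leq_pexp2l // -/M; lia. Qed.

Lemma image2_le b : size (morph h (pw psi 2 b)) <= Lam.
Proof.
rewrite /psi -pwM mulnC.
apply: leq_trans (size_morph_le _ h_le) _.
by rewrite /Lam /idem_len expnSr leq_mul2r size_pw_le ?orbT.
Qed.

Lemma P_le b : size (P b) <= Lam.
Proof.
rewrite /P /Psi; case: ifP => _; last by rewrite expn_gt0 L_gt0.
apply: leq_trans (leq_trans (psi_le b) Lam_ge).
by rewrite size_filter count_size.
Qed.

Lemma g_le b : size (g b) <= Lam.
Proof.
rewrite /g /gimage; case: ifP => _; last by rewrite expn_gt0 L_gt0.
by have := image2_le b; rewrite pwS pw1.
Qed.

Lemma word_cat j k : word (j + k) = word j ++ drop (size (word j)) (word (j + k)).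
Proof.
suff [s ->] : exists s, word (j + k) = word j ++ s by rewrite drop_size_cat.
elim: k => [|k [s IH]]; first by exists [::]; rewrite addn0 cats0.
have -> : word (j + k.+1) = word (j + k) ++ morph h (morph (pw phi (j + k)) v).
  by rewrite /word addnS pwSr phi_a morph_cons morph_cat.
by rewrite IH -catA; eexists.
Qed.

Lemma size_word_mono j k : j <= k -> size (word j) <= size (word k).
Proof. by move=> jk; rewrite -(subnKC jk) word_cat size_cat leq_addr. Qed.

Lemma word_psi_inf N j : exists k, j <= k /\ N < size (word (k * M)).
Proof.
have [k Hk] := word_inf N; exists (j + k); split; first exact: leq_addr.
apply: leq_trans Hk _; apply: size_word_mono.
by apply: leq_trans (leq_addl j k) _; rewrite leq_pmulr.
Qed.

Lemma nth_word k i : i < size (word k) -> nth x0 (word k) i = U i.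
Proof. by move=> Hi; rewrite -U_word nth_mkseq. Qed.

Lemma psi_a : exists w, psi a = a :: w.
Proof.
rewrite /psi; case: (M) M_gt0 => // k _.
elim: k => [|k [w IH]]; first by exists v; rewrite pw1.
by rewrite pwS IH morph_cons phi_a; eexists.
Qed.

Theorem ev_period_bounded p : ev_period U p ->
  exists2 q, ev_period U q & q <= period_bound #|A| L.
Proof.
move=> /least_ev_period[q Hq qmin].
have [w Ew] := psi_a.
have word_step k : word (k.+1 * M) = word (k * M) ++ morph h (morph (pw psi k) w).
  by rewrite /word !pwM pwSr -/psi Ew morph_cons morph_cat.
have [/hasP[b bw /andP[vb Gb]]|nG] := boolP (has (fun b => visible psi h b && growing P b) w).
  exists q => //; apply: leq_trans (leq_addl _ _).
  case: Hq => q0 [N HN].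
  (* Beyond [N], the least eventual period is the least period of a purely periodic word. *)
  have Xq : min_period (fun i => U (N + i)) q.
    split=> // [i|r r0 Hr]; first by rewrite addnA HN // leq_addr.
    apply: qmin; split=> //; exists N => i /subnKC Hi.
    by rewrite -Hi -addnA Hr.
  apply: (growing_bound (Psi_idem h idem) x0 Xq (Psi_gt0 h idem) P_le (@gimage_gt0 _ _ x0 psi h idem) g_le
           (@gimage_fix _ _ x0 psi h idem) Gb) => k y yb.
  have [vy yb'] : visible psi h y /\ y \in psi b.
    by move: yb; rewrite /P /Psi vb mem_filter => /andP[].
  rewrite gimage_pw //.
  have yj m : y \in pw psi m.+1 b by rewrite pw_mem.
  (* The occurrence must lie beyond position [N]. As [y] occurs in every positive power of [psi] at
     [b], its image is found in the increment that follows a word longer than [N]. *)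
  have [j [Hj HNj]] := word_psi_inf N k.+3.
  have /infixP[u [t E]] : infix (morph h (pw psi k.+2 y)) (morph h (morph (pw psi j) w)).
    apply: infix_morph; case/splitPr: bw => w1 w2.
    rewrite morph_cat morph_cons.
    apply: infix_trans (_ : infix _ (pw psi j b)) _; last by apply/infixP; eexists; eexists.
    have -> : j = k.+2 + (j - k.+3).+1 by lia.
    rewrite pwD; have := yj (j - k.+3).
    case/splitPr => w3 w4; rewrite morph_cat morph_cons.
    by apply/infixP; eexists; eexists.
  have Ej := word_step j; rewrite E in Ej.
  exists (size (word (j * M)) + size u - N).
  apply: (@eq_from_nth _ x0); first by rewrite size_mkseq.
  move=> i Hi; rewrite nth_mkseq //.
  have -> : N + (size (word (j * M)) + size u - N + i) = size (word (j * M)) + (size u + i) by lia.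
  rewrite -(@nth_word (j.+1 * M)) Ej; last by rewrite !size_cat; lia.
  rewrite nth_cat ltnNge leq_addr /= addKn nth_cat ltnNge leq_addr /= addKn nth_cat.
  by rewrite Hi.
(* Without visible growing letters in [w] the increments of the words are constant from the second
   on, so [U] is [word (2 * M)] followed by copies of [T]. *)
pose T := morph h (morph (pw psi 2) w).
have ET k : morph h (morph (pw psi k.+2) w) = T.
  rewrite /T !morph_comp; apply: eq_in_morph => x xw.
  case vx: (visible psi h x); last first.
    have inv m : morph h (pw psi m.+1 x) = [::].
      apply/eqP; rewrite -size_eq0 -leqn0 leqNgt size_morph_gt0.
      apply: contraFN vx => /hasP[z]; rewrite pw_mem => zx hz.
      by rewrite /visible size_morph_gt0; apply/hasP; exists z.
    by rewrite !inv.
  rewrite -!(gimage_pw x0 idem) // pw0 morph1.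
  have nx : ~~ growing P x by apply/negP => Gx; case/hasP: nG; exists x => //; rewrite vx.
  have := morph_gpw (@gimage_fix _ _ x0 psi h idem) (@nongrowing_closed _ _ (Psi_idem h idem)) k (s := [:: x]).
  by rewrite /= orbF => /(_ nx); rewrite !morph1.
have Ew2 k : word (k.+2 * M) = word (2 * M) ++ flatten (nseq k T).
  elim: k => [|k IH]; first by rewrite /= cats0.
  by rewrite word_step IH ET -catA flatten_nseqS.
have sT k : size (flatten (nseq k T)) = k * size T.
  by elim: k => //= k IH; rewrite size_cat IH mulSn.
have T0 : 0 < size T.
  rewrite lt0n; apply/eqP => T0.
  have [k [k2 Hk]] := word_psi_inf (size (word (2 * M))) 2.
  by move: Hk; rewrite -(subnKC k2) !addSn add0n (Ew2 (k - 2)) size_cat sT T0 muln0 addn0 ltnn.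
exists (size T).
  split=> //; exists (size (word (2 * M))) => i Hi.
  pose k := i - size (word (2 * M)) + 2.
  have Hk : i + size T < size (word (k.+2 * M)).
    rewrite Ew2 size_cat sT; have : i - size (word (2 * M)) <= (i - size (word (2 * M))) * size T by rewrite leq_pmulr.
    rewrite /k mulnDl; lia.
  rewrite -!(@nth_word (k.+2 * M)) //; last by apply: leq_ltn_trans Hk; exact: leq_addr.
  rewrite Ew2 !nth_cat ltnNge (leq_trans Hi (leq_addr _ _)) /= ltnNge Hi /=.
  rewrite -addnBAC // nth_flatten_nseq //.
  by move: Hk; rewrite Ew2 size_cat sT; lia.
apply: leq_trans (leq_addr _ _).
rewrite /T morph_comp; apply: leq_trans (size_morph_le _ image2_le) _.
rewrite leq_mul2r; apply/orP; right; apply: leq_trans (psi_le a).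
by rewrite Ew leqnSn.
Qed.
End PeriodBound.

(** * Testing a given period *)

(** The orbit is on its cycle from step [S] on, and [K] further steps run through the whole
    cycle. *)
Lemma iter_eventually (T : finType) (f : T -> T) (x : T) (P : pred T) S K :
  #|T| <= S -> #|T| <= K ->
  (forall k, S <= k < S + K -> P (iter k f x)) <-> (exists N, forall k, N <= k -> P (iter k f x)).
Proof.
move=> TS TK; have [k0 /andP[k0_gt0 k0T] E] := iter_cycle f x.
have ES i : #|T| <= i -> iter (k0 + i) f x = iter i f x.
  by move=> Ti; rewrite -(subnK Ti) addnCA !(iterD (i - _)) iterD E.
have EM m i : #|T| <= i -> iter (m * k0 + i) f x = iter i f x.
  move=> Ti; elim: m => // m IH; rewrite mulSn -addnA ES //.
  exact: leq_trans Ti (leq_addl _ _).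
split=> [H|[N H] k /andP[Sk _]].
  exists S => k Sk.
  have -> : k = (k - S) %/ k0 * k0 + (S + (k - S) %% k0).
    by have := divn_eq (k - S) k0; lia.
  rewrite EM; last by lia.
  by apply: H; have := ltn_pmod (k - S) k0_gt0; lia.
rewrite -(EM N k) ?(leq_trans TS) //; apply: H.
by apply: leq_trans (leq_addr _ _); rewrite leq_pmulr.
Qed.

Section Decide.
Variables (A B : finType) (phi : A -> seq A) (h : A -> seq B) (a : A) (v : seq A).
Hypothesis phi_a : phi a = a :: v.
Variable U : nat -> B.
Let word k := morph h (pw phi k a).
Hypothesis U_word : forall k, mkseq U (size (word k)) = word k.
Hypothesis word_inf : forall N, exists k, N < size (word k).
Variable p' : nat.
Let p := p'.+1.

(* The last [p] letters read, [None] standing for missing ones. *)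
Let Q := p.-tuple (option B).
Definition read (s : Q * bool) (x : B) : Q * bool :=
  ([tuple of rcons (behead s.1) (Some x)], s.2 || (if thead s.1 is Some y then y != x else false)).
Definition run_with (t : {ffun A -> {ffun Q -> Q * bool}}) (s : Q * bool) (w : seq A) : Q * bool :=
  foldl (fun s b => let r := t b s.1 in (r.1, s.2 || r.2)) s w.
Let config := ({ffun A -> {ffun Q -> Q * bool}} * (Q * bool))%type.
(** The table for level [k.+1] at [b] is obtained by running the level-[k] tables along [phi b]. The
    flag restarts at [false], so it reports only the mismatches in the increment that was read
    last. *)
Definition next (c : config) : config :=
  ([ffun b => [ffun q => run_with c.1 (q, false) (phi b)]], run_with c.1 (c.2.1, false) v).
Definition window (N : nat) : Q :=
  [tuple of mkseq (fun j => if p <= N + j then Some (U (N + j - p)) else None) p].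
Definition start : config :=
  ([ffun b => [ffun q => foldl read (q, false) (h b)]], ((foldl read (window 0, false) (h a)).1, false)).

Lemma read_flag q b w : foldl read (q, b) w =
  ((foldl read (q, false) w).1, b || (foldl read (q, false) w).2).
Proof.
elim: w q b => [|x w IH] q b; first by rewrite /= orbF.
by rewrite /= IH [in RHS]IH /= orbA.
Qed.

Lemma run_with_read (t : {ffun A -> {ffun Q -> Q * bool}}) f s w :
  (forall b q, t b q = foldl read (q, false) (f b)) ->
  run_with t s w = foldl read s (morph f w).
Proof.
move=> Ht; elim: w s => // b w IH s.
rewrite morph_cons foldl_cat -IH /= Ht; congr (run_with t _ w).
by rewrite [in RHS](surjective_pairing s) [RHS]read_flag.
Qed.

Lemma read_window N b : read (window N, b) (U N) =
  (window N.+1, b || ((p <= N) && (U N != U (N - p)))).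
Proof.
congr (_, _).
  apply/val_inj; pose F N j := if p <= N + j then Some (U (N + j - p)) else None.
  change (rcons (behead (mkseq (F N) p)) (Some (U N)) = mkseq (F N.+1) p).
  apply: (@eq_from_nth _ None).
    by rewrite size_rcons size_behead !size_mkseq.
  move=> j; rewrite size_rcons size_behead size_mkseq => Hj.
  rewrite nth_rcons size_behead size_mkseq nth_behead [RHS]nth_mkseq // /F addSn.
  case: (ltnP j p.-1) => Hj2; first by rewrite nth_mkseq // addnS.
  have -> : j = p' by rewrite /p /= in Hj Hj2; lia.
  by rewrite eqxx ifT /p -addnS ?leq_addl ?addnK.
have T : thead (window N) = if p <= N then Some (U (N - p)) else None.
  by rewrite /thead (tnth_nth None) nth_mkseq // addn0.
by rewrite /read T; case: ifP => //= _; rewrite eq_sym.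
Qed.

Definition mismatch (lo hi : nat) : bool :=
  has (fun i => (p <= i) && (U i != U (i - p))) (iota lo (hi - lo)).

Lemma read_word N l b : foldl read (window N, b) (slice U N l) =
  (window (N + l), b || mismatch N (N + l)).
Proof.
rewrite /mismatch addKn /slice /mkseq.
elim: l N b => [|l IH] N b; first by rewrite addn0 orbF.
have -> : [seq U (N + i) | i <- iota 0 l.+1] = U N :: [seq U (N.+1 + i) | i <- iota 0 l].
  rewrite /= addn0 (iotaDl 1 0) -map_comp; congr (_ :: _).
  by apply: eq_map => i /=; rewrite addnA addn1.
by rewrite [LHS]/= read_window IH addnS addSn /= orbA.
Qed.

Lemma word_slice k : morph h (morph (pw phi k) v) =
  slice U (size (word k)) (size (word k.+1) - size (word k)).
Proof.
have E : word k.+1 = word k ++ morph h (morph (pw phi k) v).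
  by rewrite /word pwSr phi_a morph_cons morph_cat.
have := U_word k.+1; rewrite {2}E => E2.
have := congr1 (drop (size (word k))) E2; rewrite drop_size_cat // => <-.
apply: (@eq_from_nth _ (U 0)); first by rewrite size_drop !size_mkseq.
move=> i; rewrite size_drop size_mkseq => Hi.
by rewrite nth_drop !nth_mkseq //; lia.
Qed.

Lemma size_wordS k : size (word k) <= size (word k.+1).
Proof. by rewrite /word pwSr phi_a morph_cons morph_cat size_cat leq_addr. Qed.

Lemma size_word_le j k : j <= k -> size (word j) <= size (word k).
Proof.
move=> jk; rewrite -(subnKC jk); elim: (k - j) => [|i IH]; first by rewrite addn0.
by rewrite addnS (leq_trans IH) ?size_wordS.
Qed.

Lemma iter_next k : [/\ forall b q, (iter k next start).1 b q = foldl read (q, false) (morph h (pw phi k b)),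
  (iter k next start).2.1 = window (size (word k)) &
  forall j, k = j.+1 -> (iter k next start).2.2 = mismatch (size (word j)) (size (word k))].
Proof.
elim: k => [|k [IH1 IH2 _]].
  split=> // [b q|]; first by rewrite !ffunE pw0 morph1.
  have W0 : word 0 = h a by rewrite /word pw0 morph1.
  have W1 : h a = slice U 0 (size (h a)) by have := U_word 0; rewrite W0.
  by rewrite W0 /= {1}W1 read_word /= add0n.
have R s w : run_with (iter k next start).1 s w = foldl read s (morph h (morph (pw phi k) w)).
  by rewrite morph_comp; apply: run_with_read.
have H : run_with (iter k next start).1 ((iter k next start).2.1, false) v =
    (window (size (word k.+1)), mismatch (size (word k)) (size (word k.+1))).
  by rewrite R IH2 word_slice read_word /= subnKC // size_wordS.
split=> [b q||j [<-]]; rewrite iterS /next.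
- by rewrite !ffunE R pwSr.
- by rewrite H.
- by rewrite H.
Qed.

Lemma ev_periodE : ev_period U p <-> exists N, forall k, N <= k ->
  ~~ mismatch (size (word k)) (size (word k.+1)).
Proof.
have inf N : exists k, N <= size (word k) by have [k /ltnW Hk] := word_inf N; exists k.
split=> [[_ [N HN]]|[N HN]].
  have [K HK] := inf (N + p).
  exists K => k Kk; apply/hasPn => i; rewrite mem_iota => Hi.
  have Hk := leq_trans HK (size_word_le Kk).
  have Ni : N + p <= i by apply: leq_trans Hk _; case/andP: Hi.
  have pi : p <= i by apply: leq_trans (leq_addl _ _) Ni.
  by rewrite pi negbK -{1}(subnK pi) HN // leq_subRL // addnC.
split=> //; exists (size (word N)) => i Hi.
have [K HK] := inf (i + p).+1.
have [k [Nk H1 H2]] : exists k, [/\ N <= k, size (word k) <= i + p & i + p < size (word k.+1)].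
  have ex : exists k, i + p < size (word k) by exists K.
  case: (ex_minnP ex) => -[|k] Hk Hmin.
    by have := size_word_le (leq0n N); lia.
  exists k; split=> //.
    rewrite leqNgt; apply/negP => kN; have := size_word_le kN; lia.
  by rewrite leqNgt; apply/negP => /Hmin; rewrite ltnn.
have /hasPn/(_ (i + p)) := HN _ Nk.
rewrite mem_iota subnKC ?size_wordS // H1 H2 => /(_ isT).
by rewrite leq_addl addnK negbK => /eqP.
Qed.

Definition config_card : nat :=
  (((#|B|.+1 ^ p) * 2) ^ (#|B|.+1 ^ p)) ^ #|A| * (#|B|.+1 ^ p * 2).

Lemma card_config : #|{: config}| = config_card.
Proof. by rewrite !card_prod !card_ffun !card_prod card_bool card_tuple card_option. Qed.

Theorem ev_period_test K : config_card <= K ->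
  ev_period U p <-> (forall i, size (word K) <= i < size (word (K + K)) -> p <= i -> U i = U (i - p)).
Proof.
move=> HK; rewrite ev_periodE.
have fl k : (iter k.+1 next start).2.2 = mismatch (size (word k)) (size (word k.+1)).
  by have [_ _ /(_ k erefl)] := iter_next k.+1.
have E1 : (exists N, forall k, N <= k -> ~~ mismatch (size (word k)) (size (word k.+1))) <->
  (exists N, forall k, N <= k -> ~~ (iter k next start).2.2).
  split=> -[N HN].
    by exists N.+1 => -[|k] //; rewrite fl; exact: HN.
  by exists N => k Nk; rewrite -fl; apply: HN; exact: leqW.
(* The start is [K.+1] because configuration [k.+1] carries the flag of the increment from [word k]
   to [word k.+1]. *)
rewrite E1 -(@iter_eventually config next start (fun c => ~~ c.2.2) K.+1 K) ?card_config //; last exact: leqW.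
split=> [H i Hi pi|H [|k] // Hk].
  have [k [Nk H1 H2]] : exists k, [/\ K <= k < K + K, size (word k) <= i & i < size (word k.+1)].
    have ex : exists k, i < size (word k) by exists (K + K); case/andP: Hi.
    case: (ex_minnP ex) => -[|k] Hk Hmin.
      by have := size_word_le (leq0n K); lia.
    have HK2 : k < K + K by apply: Hmin; case/andP: Hi.
    exists k; split=> //.
      rewrite HK2 andbT leqNgt; apply/negP => kN; have := size_word_le kN; lia.
    by rewrite leqNgt; apply/negP => /Hmin; rewrite ltnn.
  have := H k.+1; rewrite !ltnS Nk => /(_ isT); rewrite fl => /hasPn/(_ i).
  by rewrite mem_iota subnKC ?size_wordS // H1 H2 pi negbK => /(_ isT)/eqP.
rewrite fl; apply/hasPn => i; rewrite mem_iota subnKC ?size_wordS // => Hi.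
rewrite negb_and negbK; case: (leqP p i) => //= pi; apply/eqP/H => //.
have Hk1 : K <= k by lia.
have Hk2 : k.+1 <= K + K by lia.
have := size_word_le Hk1; have := size_word_le Hk2; lia.
Qed.
End Decide.

(** * Correctness of the decision *)

Definition test_bound (n m P : nat) : nat :=
  (((m.+1 ^ P) * 2) ^ (m.+1 ^ P)) ^ n * (m.+1 ^ P * 2).

Definition has_period_after (N P : nat) (u : seq nat) : bool :=
  has (fun p => (0 < p) &&
    all (fun i => [|| i < N, i < p | nth 0 u i == nth 0 u (i - p)]) (iota 0 (size u)))
  (iota 0 P.+1).

Lemma test_bound_mono n m p P : p <= P -> test_bound n m p <= test_bound n m P.
Proof.
move=> pP; have H : m.+1 ^ p <= m.+1 ^ P by rewrite leq_pexp2l.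
have H0 : 0 < m.+1 ^ p by rewrite expn_gt0.
apply: leq_mul; last by rewrite leq_mul2r H orbT.
case: n => [|n]; first by rewrite !expn0.
rewrite leq_exp2r //; apply: leq_trans (_ : (m.+1 ^ P * 2) ^ (m.+1 ^ p) <= _).
  by rewrite leq_exp2r // leq_mul2r H orbT.
by rewrite leq_pexp2l // muln_gt0 expn_gt0.
Qed.

Section Bridge.
Variables (n m : nat) (phi : 'I_n -> seq 'I_n) (h : 'I_n -> seq 'I_m) (a : 'I_n).
Hypothesis ext : extends_over phi a.
Hypothesis inf : infinite_image h (fixpoint phi a).
Let word k := morph h (pw phi k a).
Let fix_word := fixpoint phi a.

Lemma pw_prefix j k : exists s, pw phi (j + k) a = pw phi j a ++ s.
Proof.
case: ext => v [Ev _]; elim: k => [|k [s IH]]; first by exists [::]; rewrite addn0 cats0.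
by rewrite addnS pwSr Ev morph_cons IH -catA; eexists.
Qed.

Lemma size_pw_gt k : k < size (pw phi k a).
Proof.
case: ext => v [Ev Hv]; elim: k => // k IH.
rewrite pwSr Ev morph_cons size_cat -iter_morph.
by have := Hv k; case: (iter k _ v) => // b s _; rewrite /= addnS ltnS ltn_addr.
Qed.

Lemma nth_pw j k i : i < size (pw phi j a) -> i < size (pw phi k a) ->
  nth a (pw phi j a) i = nth a (pw phi k a) i.
Proof.
move=> Hj Hk; have [s E] := pw_prefix j k; have [t E2] := pw_prefix k j.
have := congr1 (fun w => nth a w i) E; rewrite nth_cat Hj => <-.
by rewrite addnC E2 nth_cat Hk.
Qed.

Lemma fix_pw k : mkseq fix_word (size (pw phi k a)) = pw phi k a.
Proof.
apply: (@eq_from_nth _ a); rewrite size_mkseq // => i Hi.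
by rewrite nth_mkseq // /fix_word /fixpoint -/(pw phi i a) (nth_pw _ Hi) // size_pw_gt.
Qed.

Lemma fix_prefix k : exists s, pw phi k a = mkseq fix_word k ++ s.
Proof.
exists (drop k (pw phi k a)); rewrite -{1}(cat_take_drop k (pw phi k a)); congr (_ ++ _).
rewrite -fix_pw; apply: (@eq_from_nth _ a).
  by rewrite size_takel ?size_mkseq // ltnW // size_pw_gt.
rewrite size_takel; last by rewrite size_mkseq ltnW // size_pw_gt.
move=> i Hi; rewrite nth_take // !nth_mkseq //.
exact: ltn_trans Hi (size_pw_gt k).
Qed.

Lemma word_inf N : exists k, N < size (word k).
Proof.
have [k Hk] := inf N; exists k; have [s E] := fix_prefix k.
by rewrite /word E morph_cat size_cat (leq_trans Hk) // leq_addr.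
Qed.

Lemma image_word U : is_image h fix_word U -> forall k, mkseq U (size (word k)) = word k.
Proof. by move=> HU k; have := HU (size (pw phi k a)); rewrite fix_pw. Qed.

(** Each letter is read from some word that is long enough; the words are prefixes of one another,
    so the choice does not matter. *)
Lemma image_exists : exists U : nat -> 'I_m, is_image h fix_word U.
Proof.
have [k0 Hk0] := word_inf 0.
have x0 : 'I_m by case: (word k0) Hk0.
pose U i := nth x0 (word (xchoose (word_inf i))) i.
have HU k i : i < size (word k) -> nth x0 (word k) i = U i.
  rewrite /U; have := xchooseP (word_inf i); set j := xchoose _ => Hj Hi.
  have [s E] := pw_prefix j k; have [t E2] := pw_prefix k j.
  have := congr1 (fun w => nth x0 (morph h w) i) E; rewrite morph_cat nth_cat -/(word j) Hj => <-.
  by rewrite addnC E2 morph_cat nth_cat -/(word k) Hi.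
exists U => k; have [s E] := fix_prefix k.
apply: (@eq_from_nth _ x0); rewrite size_mkseq // => i Hi.
rewrite nth_mkseq // -(HU k) /word E morph_cat; first by rewrite nth_cat Hi.
by rewrite size_cat; apply: leq_trans Hi (leq_addr _ _).
Qed.

Variable L : nat.
Hypothesis phi_le : forall b, size (phi b) <= L.
Hypothesis h_le : forall b, size (h b) <= L.

Definition verdict : bool :=
  let P := period_bound n L in let K := test_bound n m P in
  has_period_after (size (word K)) P (map val (word (K + K))).

Theorem verdictP : image_ultimately_periodic h fix_word <-> verdict.
Proof.
set P := period_bound n L; set K := test_bound n m P.
case: (ext) => v [Ev _].
have test U p : (forall k, mkseq U (size (word k)) = word k) -> 0 < p <= P ->
  ev_period U p <->
  all (fun i => [|| i < size (word K), i < p |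
     nth 0 (map val (word (K + K))) i == nth 0 (map val (word (K + K))) (i - p)])
     (iota 0 (size (map val (word (K + K))))).
  move=> HU /andP[]; case: p => // p _ pP.
  (* By monotonicity one [K] serves all candidate periods up to [P]. *)
  have KP : config_card 'I_n 'I_m p <= K.
    by rewrite /config_card !card_ord; exact: test_bound_mono.
  rewrite (ev_period_test Ev HU word_inf KP).
  have nthU i : i < size (word (K + K)) -> nth 0 (map val (word (K + K))) i = val (U i).
    by move=> Hi; rewrite (nth_map (U 0)) // -[X in nth _ X]HU nth_mkseq.
  split=> [H|/allP H i /andP[Hi1 Hi2] pi].
    apply/allP => i; rewrite mem_iota size_map => /= Hi.
    case: ltnP => //= H1; case: ltnP => //= H2.
    by rewrite !nthU ?(leq_ltn_trans (leq_subr _ _)) // (H i) ?H1.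
  have := H i; rewrite mem_iota size_map => /(_ Hi2).
  rewrite ltnNge Hi1 ltnNge pi /= !nthU ?(leq_ltn_trans (leq_subr _ _)) //.
  by move=> /eqP/val_inj.
have [U0 HU0] := image_exists.
split=> [[U [HU [p [N [p0 HN]]]]]|/hasP[p]].
  have [q [q0 Hq] qP] : exists2 q, ev_period U q & q <= P.
    have := ev_period_bounded Ev phi_le h_le (image_word HU) word_inf (p := p).
    by rewrite card_ord; apply; split=> //; exists N.
  apply/hasP; exists q; first by rewrite mem_iota.
  rewrite q0 /=; apply/(test U q (image_word HU)) => //.
  by rewrite q0.
rewrite mem_iota /= add0n ltnS => pP /andP[p0 H].
have pp : 0 < p <= P by rewrite p0.
have [_ [N HN]] := (test U0 p (image_word HU0) pp).2 H.
by exists U0; split=> //; exists p, N.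
Qed.
End Bridge.

(** * Primitive recursive functions *)

(** Agreement is demanded only on lists of length [N]: recursion passes its parameters on by
    projections, whose number must be known. *)
Definition computable (N : nat) (f : seq nat -> nat) : Prop :=
  exists c : code, forall v, size v = N -> eval c v (f v).

Section Closure.
Variable N : nat.
Implicit Types f g b l : seq nat -> nat.

Lemma comp_ext f g : (forall v, f v = g v) -> computable N f -> computable N g.
Proof. by move=> E [c Hc]; exists c => v Hv; rewrite -E; exact: Hc. Qed.

Lemma comp_nth i : computable N (fun v => nth 0 v i).
Proof. by exists (CProj i) => v _; exact: ev_proj. Qed.

Lemma comp_S f : computable N f -> computable N (fun v => (f v).+1).
Proof.
case=> c Hc; exists (CComp CSucc [:: c]) => v Hv.
apply: (@ev_comp _ _ _ [:: f v]); last exact: (ev_succ [:: f v]).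
by apply: evs_cons (Hc v Hv) (evs_nil v).
Qed.

Lemma comp_const k : computable N (fun _ => k).
Proof.
elim: k => [|k IH]; first by exists CZero => v _; exact: ev_zero.
exact: (comp_S IH).
Qed.

Lemma evals_proj v k m : evals [seq CProj i | i <- iota k m] v [seq nth 0 v i | i <- iota k m].
Proof.
elim: m k => [|m IH] k; first exact: evs_nil.
by apply: evs_cons; [exact: ev_proj | exact: IH].
Qed.

(** The step receives the counter, the accumulator and then the original arguments, which [drop 2]
    recovers. *)
Lemma comp_rec f b (S : nat -> nat -> seq nat -> nat) : computable N f -> computable N b ->
  computable N.+2 (fun w => S (nth 0 w 0) (nth 0 w 1) (drop 2 w)) ->
  computable N (fun v => iteri (f v) (fun k r => S k r v) (b v)).
Proof.
move=> [cf Hf] [cb Hb] [cs Hs].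
exists (CComp (CPrimRec cb cs) (cf :: [seq CProj i | i <- iota 0 N])) => v Hv.
apply: (@ev_comp _ _ _ (f v :: v)).
  apply: evs_cons; first exact: Hf.
  have E : [seq nth 0 v i | i <- iota 0 N] = v by rewrite -Hv map_nth_iota0 // take_size.
  by rewrite -[X in evals _ _ X]E; exact: evals_proj.
elim: (f v) => [|k IH]; first by apply: ev_prim0; exact: Hb.
apply: ev_primS IH _.
by have := Hs [:: k, iteri k (fun k r => S k r v) (b v) & v]; rewrite /= drop0 Hv; apply.
Qed.

Lemma comp_drop2 f : computable N f -> computable N.+2 (fun w => f (drop 2 w)).
Proof.
case=> c Hc; exists (CComp c [seq CProj i | i <- iota 2 N]) => w Hw.
apply: (@ev_comp _ _ _ (drop 2 w)); last by apply: Hc; rewrite size_drop Hw !subSS subn0.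
have -> : drop 2 w = [seq nth 0 w i | i <- iota 2 N].
  apply: (@eq_from_nth _ 0); first by rewrite size_drop size_map size_iota Hw !subSS subn0.
  move=> i; rewrite size_drop Hw !subSS subn0 => Hi.
  by rewrite nth_drop (nth_map 0) ?size_iota // nth_iota.
exact: evals_proj.
Qed.
End Closure.

Ltac comp_base := first [exact: comp_nth | exact: comp_const | assumption | apply: comp_drop2; assumption].

Section Arith.
Variable N : nat.
Implicit Types f g b l : seq nat -> nat.

Lemma comp_add f g : computable N f -> computable N g -> computable N (fun v => f v + g v).
Proof.
move=> Hf Hg; apply: (@comp_ext _ (fun v => iteri (f v) (fun _ r => r.+1) (g v))).
  by move=> v; elim: (f v) => //= k ->.
by apply: (comp_rec (S := fun _ r _ => r.+1)) => //; apply: comp_S; comp_base.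
Qed.
End Arith.

Section Arith2.
Variable N : nat.
Implicit Types f g b l : seq nat -> nat.

Lemma comp_mul f g : computable N f -> computable N g -> computable N (fun v => f v * g v).
Proof.
move=> Hf Hg; apply: (@comp_ext _ (fun v => iteri (f v) (fun _ r => g v + r) 0)).
  by move=> v; elim: (f v) => //= k ->; rewrite mulSn.
by apply: (comp_rec (S := fun _ r v => g v + r)) => //; [|apply: comp_add]; comp_base.
Qed.

Lemma comp_pred f : computable N f -> computable N (fun v => (f v).-1).
Proof.
move=> Hf; apply: (@comp_ext _ (fun v => iteri (f v) (fun k _ => k) 0)).
  by move=> v; case: (f v).
by apply: (comp_rec (S := fun k _ _ => k)) => //; comp_base.
Qed.
End Arith2.

Section Arith3.
Variable N : nat.
Implicit Types f g b l : seq nat -> nat.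

Lemma comp_exp f g : computable N f -> computable N g -> computable N (fun v => f v ^ g v).
Proof.
move=> Hf Hg; apply: (@comp_ext _ (fun v => iteri (g v) (fun _ r => f v * r) 1)).
  by move=> v; elim: (g v) => //= k ->; rewrite expnS.
by apply: (comp_rec (S := fun _ r v => f v * r)) => //; [|apply: comp_mul]; comp_base.
Qed.

Lemma comp_fact f : computable N f -> computable N (fun v => (f v)`!).
Proof.
move=> Hf; apply: (@comp_ext _ (fun v => iteri (f v) (fun k r => k.+1 * r) 1)).
  by move=> v; elim: (f v) => //= k ->; rewrite factS.
by apply: (comp_rec (S := fun k r v => k.+1 * r)) => //; [|apply: comp_mul; [apply: comp_S|]]; comp_base.
Qed.

Lemma comp_sub f g : computable N f -> computable N g -> computable N (fun v => f v - g v).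
Proof.
move=> Hf Hg; apply: (@comp_ext _ (fun v => iteri (g v) (fun _ r => r.-1) (f v))).
  by move=> v; elim: (g v) => [|k IH] /=; rewrite ?subn0 // IH subnS.
by apply: (comp_rec (S := fun _ r _ => r.-1)) => //; apply: comp_pred; comp_base.
Qed.
End Arith3.

Section Arith4.
Variable N : nat.
Implicit Types f g b l : seq nat -> nat.

Lemma comp_half f : computable N f -> computable N (fun v => f v %/ 2).
Proof.
(* The halves of [k] and of [k.+1], rounded down, add up to [k]. *)
move=> Hf; apply: (@comp_ext _ (fun v => iteri (f v) (fun k r => k - r) 0)).
  by move=> v; elim: (f v) => //= k ->; lia.
by apply: (comp_rec (S := fun k r _ => k - r)) => //; [|apply: comp_sub]; comp_base.
Qed.

Lemma comp_leq f g : computable N f -> computable N g -> computable N (fun v => f v <= g v).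
Proof.
move=> Hf Hg; apply: (@comp_ext _ (fun v => 1 - (f v - g v))).
  by move=> v; case: leqP; lia.
by apply: comp_sub; [exact: comp_const|exact: comp_sub].
Qed.

Lemma comp_and (f g : seq nat -> bool) : computable N f -> computable N g -> computable N (fun v => f v && g v).
Proof.
move=> Hf Hg; apply: (@comp_ext _ (fun v => f v * g v)); last exact: comp_mul.
by move=> v; case: (f v); case: (g v).
Qed.

Lemma comp_not (f : seq nat -> bool) : computable N f -> computable N (fun v => ~~ f v).
Proof.
move=> Hf; apply: (@comp_ext _ (fun v => 1 - f v)); first by move=> v; case: (f v).
by apply: comp_sub => //; exact: comp_const.
Qed.

Lemma comp_or (f g : seq nat -> bool) : computable N f -> computable N g -> computable N (fun v => f v || g v).
Proof.
move=> Hf Hg; apply: (@comp_ext _ (fun v => ~~ (~~ f v && ~~ g v))).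
  by move=> v; case: (f v); case: (g v).
by apply: comp_not; apply: comp_and; apply: comp_not.
Qed.

Lemma comp_eq f g : computable N f -> computable N g -> computable N (fun v => f v == g v).
Proof.
move=> Hf Hg; apply: (@comp_ext _ (fun v => (f v <= g v) && (g v <= f v))).
  by move=> v; rewrite eqn_leq.
by apply: comp_and; apply: comp_leq.
Qed.

Lemma comp_if (p : seq nat -> bool) f g : computable N p -> computable N f -> computable N g ->
  computable N (fun v => if p v then f v else g v).
Proof.
move=> Hp Hf Hg; apply: (@comp_ext _ (fun v => p v * f v + (1 - p v) * g v)).
  by move=> v; case: (p v); rewrite ?mul1n ?mul0n ?addn0.
by apply: comp_add; apply: comp_mul => //; apply: comp_sub => //; exact: comp_const.
Qed.

Lemma comp_pair f g : computable N f -> computable N g -> computable N (fun v => cantor_pair (f v) (g v)).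
Proof.
move=> Hf Hg; apply: comp_add => //; apply: comp_half; apply: comp_mul; first exact: comp_add.
by apply: comp_S; exact: comp_add.
Qed.
End Arith4.

Lemma comp_has (N : nat) (b : seq nat -> nat) (P : nat -> seq nat -> bool) : computable N b ->
  computable N.+2 (fun w => P (nth 0 w 0) (drop 2 w)) ->
  computable N (fun v => has (fun i => P i v) (iota 0 (b v))).
Proof.
move=> Hb HP; apply: (@comp_ext _ (fun v => iteri (b v) (fun k r => (0 < r) || P k v) 0)).
  move=> v; elim: (b v) => // k IH.
  rewrite -addn1 iotaD has_cat /= orbF addn1 /= IH.
  by case: (has _ _).
apply: (comp_rec (S := fun k r v => (0 < r) || P k v)) => //; first exact: comp_const.
by apply: comp_or => //; apply: comp_leq; comp_base.
Qed.

Lemma comp_all (N : nat) (b : seq nat -> nat) (P : nat -> seq nat -> bool) : computable N b ->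
  computable N.+2 (fun w => P (nth 0 w 0) (drop 2 w)) ->
  computable N (fun v => all (fun i => P i v) (iota 0 (b v))).
Proof.
move=> Hb HP; apply: (@comp_ext _ (fun v => ~~ has (fun i => ~~ P i v) (iota 0 (b v)))).
  by move=> v; rewrite -all_predC; congr nat_of_bool; apply: eq_all => i /=; rewrite negbK.
by apply: comp_not; apply: comp_has => //; exact: comp_not.
Qed.

(** * Inverting the Cantor pairing *)

Definition tri w := w * w.+1 %/ 2.
(** The largest [r] with [tri r <= z], which is [x + y] for [z = cantor_pair x y]; it grows by at
    most one when [z] does. *)
Definition root (z : nat) : nat := iteri z (fun k r => if tri r.+1 <= k.+1 then r.+1 else r) 0.
Definition unpair2 z := z - tri (root z).
Definition unpair1 z := root z - unpair2 z.

Lemma triS w : tri w.+1 = tri w + w.+1.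
Proof.
rewrite /tri; have -> : w.+1 * w.+2 = w.+1 * 2 + w * w.+1 by nia.
by rewrite divnMDl // addnC.
Qed.

Lemma tri_mono i j : i <= j -> tri i <= tri j.
Proof. by move=> ij; apply: leq_div2r; nia. Qed.

Lemma rootP z : tri (root z) <= z < tri (root z).+1.
Proof.
elim: z => [|z IH] //; rewrite {1 2}/root /= -/(root z).
have := triS (root z); have := triS (root z).+1.
case: ifP; lia.
Qed.

Lemma root_unique z w : tri w <= z < tri w.+1 -> root z = w.
Proof.
move=> Hw; have Hr := rootP z.
case: (ltngtP (root z) w) => // H; have := tri_mono H; lia.
Qed.

Lemma unpairK z : cantor_pair (unpair1 z) (unpair2 z) = z.
Proof.
have := rootP z; rewrite triS => H.
rewrite /cantor_pair /unpair1 subnK; last by rewrite /unpair2; lia.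
by rewrite -/(tri _) /unpair2; lia.
Qed.

Lemma root_pair x y : root (cantor_pair x y) = x + y.
Proof. by apply: root_unique; rewrite triS /cantor_pair -/(tri _); lia. Qed.

Lemma unpair2_pair x y : unpair2 (cantor_pair x y) = y.
Proof. by rewrite /unpair2 root_pair /cantor_pair -/(tri _); lia. Qed.

Lemma unpair1_pair x y : unpair1 (cantor_pair x y) = x.
Proof. by rewrite /unpair1 unpair2_pair root_pair addnK. Qed.

Section Unpair.
Variable N : nat.
Implicit Types f g b l : seq nat -> nat.

Lemma comp_tri f : computable N f -> computable N (fun v => tri (f v)).
Proof. by move=> Hf; apply: comp_half; apply: comp_mul => //; exact: comp_S. Qed.
End Unpair.

Lemma comp_root N f : computable N f -> computable N (fun v => root (f v)).
Proof.
move=> Hf; apply: (comp_rec (S := fun k r _ => if tri r.+1 <= k.+1 then r.+1 else r)) => //.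
  exact: comp_const.
apply: comp_if; [apply: comp_leq; [apply: comp_tri|]|..|comp_base]; apply: comp_S; comp_base.
Qed.

Lemma comp_unpair2 N f : computable N f -> computable N (fun v => unpair2 (f v)).
Proof. by move=> Hf; apply: comp_sub => //; apply: comp_tri; exact: comp_root. Qed.

Lemma comp_unpair1 N f : computable N f -> computable N (fun v => unpair1 (f v)).
Proof. by move=> Hf; apply: comp_sub; [exact: comp_root|exact: comp_unpair2]. Qed.

(** * Lists and the program *)

Fixpoint decode_fuel (k n : nat) : seq nat :=
  if k is k'.+1 then
    if n is n'.+1 then unpair1 n' :: decode_fuel k' (unpair2 n') else [::]
  else [::].
Definition decode n := decode_fuel n n.

Lemma unpair2_le z : unpair2 z <= z.
Proof. exact: leq_subr. Qed.

Lemma decode_fuelE k n : n <= k -> code_list (decode_fuel k n) = n.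
Proof.
elim: k n => [|k IH] [|n] //= Hn.
by rewrite IH ?unpairK //; apply: leq_trans (unpair2_le n) _.
Qed.

Lemma code_listK s : decode (code_list s) = s.
Proof.
suff H k : code_list s <= k -> decode_fuel k (code_list s) = s by exact: H.
elim: s k => [|x s IH] [|k] //=; rewrite ltnS => H.
rewrite unpair1_pair unpair2_pair IH //.
by apply: leq_trans H; rewrite -{1}(unpair2_pair x (code_list s)) unpair2_le.
Qed.

Lemma decodeK n : code_list (decode n) = n.
Proof. exact: decode_fuelE. Qed.

Lemma decodeS n : decode n.+1 = unpair1 n :: decode (unpair2 n).
Proof. by rewrite -{1}(unpairK n) -{1}(decodeK (unpair2 n)) -[_.+1]/(code_list (_ :: _)) code_listK. Qed.

Lemma size_decode n : size (decode n) <= n.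
Proof.
elim/ltn_ind: n => -[|n] IH //; rewrite decodeS /= ltnS.
by apply: leq_trans (IH _ _) (unpair2_le n); rewrite ltnS unpair2_le.
Qed.

(** The recursion state pairs the accumulator with the code of the remaining list. The number of
    steps is the code itself, which is at least the length of the list, and steps on an empty list
    change nothing. *)
Lemma comp_fold (N : nat) (f b : seq nat -> nat) (F : nat -> nat -> seq nat -> nat) :
  computable N f -> computable N b -> computable N.+2 (fun w => F (nth 0 w 0) (nth 0 w 1) (drop 2 w)) ->
  computable N (fun v => foldl (fun a x => F a x v) (b v) (decode (f v))).
Proof.
move=> Hf Hb HF.
pose step (s : nat) v := if unpair2 s == 0 then s
  else cantor_pair (F (unpair1 s) (unpair1 (unpair2 s).-1) v) (unpair2 (unpair2 s).-1).
apply: (@comp_ext _ (fun v => unpair1 (iteri (f v) (fun _ s => step s v) (cantor_pair (b v) (f v))))).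
  move=> v; suff H k a n : size (decode n) <= k ->
      unpair1 (iteri k (fun _ s => step s v) (cantor_pair a n)) = foldl (fun a x => F a x v) a (decode n).
    by apply: H; exact: size_decode.
  have iteriSr m x : iteri m.+1 (fun _ s => step s v) x = iteri m (fun _ s => step s v) (step x v).
    by elim: m x => //= m IH x; rewrite -IH.
  elim: k a n => [|k IH] a n; first by case: (decode n) => //= _; rewrite unpair1_pair.
  rewrite iteriSr /step unpair2_pair; case: n => [|n] Hn.
    by rewrite IH.
  rewrite decodeS unpair1_pair /= IH //.
  by move: Hn; rewrite decodeS.
apply: comp_unpair1; apply: (comp_rec (S := fun _ s v => step s v)) => //; first exact: comp_pair.
have H1 : computable N.+2 (fun w => unpair2 (nth 0 w 1)) by apply: comp_unpair2; comp_base.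
apply: comp_if; [apply: comp_eq => //|..]; try comp_base.
apply: comp_pair; last by apply: comp_unpair2; exact: comp_pred.
have [c Hc] := HF.
have [c1 Hc1] : computable N.+2 (fun w => unpair1 (nth 0 w 1)) by apply: comp_unpair1; comp_base.
have [c2 Hc2] : computable N.+2 (fun w => unpair1 (unpair2 (nth 0 w 1)).-1).
  by apply: comp_unpair1; exact: comp_pred.
(* [F] is called on two computed values followed by the unchanged parameters [drop 2 w]. *)
exists (CComp c (c1 :: c2 :: [seq CProj i | i <- iota 2 N])) => w Hw.
have Ed : [seq nth 0 w i | i <- iota 2 N] = drop 2 w.
  apply: (@eq_from_nth _ 0); first by rewrite size_drop size_map size_iota Hw !subSS subn0.
  move=> i; rewrite size_map size_iota => Hi.
  by rewrite nth_drop (nth_map 0) ?size_iota // nth_iota.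
apply: (@ev_comp _ _ _ (unpair1 (nth 0 w 1) :: unpair1 (unpair2 (nth 0 w 1)).-1 :: drop 2 w)).
  apply: evs_cons (Hc1 _ Hw) _; apply: evs_cons (Hc2 _ Hw) _.
  by rewrite -Ed; exact: evals_proj.
have := Hc (unpair1 (nth 0 w 1) :: unpair1 (unpair2 (nth 0 w 1)).-1 :: drop 2 w).
by rewrite /= size_drop Hw !subSS subn0 drop0; apply.
Qed.

(** Reversed concatenation is what a left fold computes; [comp_flatmap] collects its result in
    reverse and reverses it at the end. *)
Definition catrev_code s t := code_list (catrev (decode s) (decode t)).
Definition nth_code s i := nth 0 (decode s) i.
Definition flatmap_code T s :=
  code_list (flatten [seq decode (nth_code T x) | x <- decode s]).

Section Lists.
Variable N : nat.
Implicit Types f g b l : seq nat -> nat.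

Lemma comp_catrev f g : computable N f -> computable N g -> computable N (fun v => catrev_code (f v) (g v)).
Proof.
move=> Hf Hg; apply: (@comp_ext _ (fun v => foldl (fun a x => (cantor_pair x a).+1) (g v) (decode (f v)))).
  move=> v; rewrite /catrev_code -{1}(decodeK (g v)).
  by elim: (decode (f v)) (decode (g v)) => //= x s IH t; rewrite -IH.
apply: (comp_fold (F := fun a x _ => (cantor_pair x a).+1)) => //.
by apply: comp_S; apply: comp_pair; comp_base.
Qed.

Lemma comp_size f : computable N f -> computable N (fun v => size (decode (f v))).
Proof.
move=> Hf; apply: (@comp_ext _ (fun v => foldl (fun a x => a.+1) 0 (decode (f v)))).
  move=> v; rewrite -[RHS]addn0; elim: (decode _) 0 => //= x s IH a.
  by rewrite IH addnS.
by apply: (comp_fold (F := fun a _ _ => a.+1)) => //; [|apply: comp_S]; comp_base.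
Qed.

Lemma comp_nth_code f g : computable N f -> computable N g -> computable N (fun v => nth_code (f v) (g v)).
Proof.
move=> Hf Hg.
apply: (@comp_ext _ (fun v => unpair1 (iteri (g v) (fun _ s => unpair2 s.-1) (f v)).-1)).
  move=> v; rewrite /nth_code; move: (f v) (g v) => n i.
  have iteriSr m x : iteri m.+1 (fun _ s => unpair2 s.-1) x = iteri m (fun _ s => unpair2 s.-1) (unpair2 x.-1).
    by elim: m x => //= m IH x; rewrite -IH.
  elim: i n => [|i IH] n; first by case: n => //= n; rewrite decodeS.
  rewrite iteriSr IH; case: n => [|n]; first by rewrite !nth_nil.
  by rewrite decodeS.
apply: comp_unpair1; apply: comp_pred; apply: (comp_rec (S := fun _ s _ => unpair2 s.-1)) => //.
by apply: comp_unpair2; apply: comp_pred; comp_base.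
Qed.
End Lists.

Lemma comp_flatmap (N : nat) (f g : seq nat -> nat) : computable N f -> computable N g -> computable N (fun v => flatmap_code (f v) (g v)).
Proof.
move=> Hf Hg.
apply: (@comp_ext _ (fun v => catrev_code (foldl (fun a x => catrev_code (nth_code (f v) x) a) 0 (decode (g v))) 0)).
  move=> v; rewrite /flatmap_code.
  suff -> : foldl (fun a x => catrev_code (nth_code (f v) x) a) 0 (decode (g v)) =
     code_list (rev (flatten [seq decode (nth_code (f v) x) | x <- decode (g v)])).
    by rewrite /catrev_code code_listK catrevE revK cats0.
  rewrite -[rev _]cats0 -[RHS]/(code_list (_ ++ decode 0)) -[LHS]decodeK; congr code_list.
  elim: (decode (g v)) 0 => //= x s IH a.
  by rewrite IH /catrev_code code_listK catrevE rev_cat catA.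
apply: comp_catrev; last exact: comp_const.
apply: (comp_fold (F := fun a x v => catrev_code (nth_code (f v) x) a)) => //; first exact: comp_const.
by apply: comp_catrev; [apply: comp_nth_code|]; comp_base.
Qed.

Lemma comp_iter_flatmap (N : nat) (k f g : seq nat -> nat) : computable N k -> computable N f -> computable N g ->
  computable N (fun v => iter (k v) (flatmap_code (f v)) (g v)).
Proof.
move=> Hk Hf Hg; apply: (@comp_ext _ (fun v => iteri (k v) (fun _ r => flatmap_code (f v) r) (g v))).
  by move=> v; elim: (k v) => //= i ->.
by apply: (comp_rec (S := fun _ r v => flatmap_code (f v) r)) => //; apply: comp_flatmap; comp_base.
Qed.

Lemma comp_has_period_after (N : nat) (a b l : seq nat -> nat) : computable N a -> computable N b -> computable N l ->
  computable N (fun v => has_period_after (a v) (b v) (decode (l v))).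
Proof.
move=> Ha Hb Hl.
pose P p v := (0 < p) && all (fun i => [|| i < a v, i < p | nth_code (l v) i == nth_code (l v) (i - p)])
   (iota 0 (size (decode (l v)))).
apply: (comp_has (P := P)); first exact: comp_S.
apply: comp_and; first by apply: comp_leq; comp_base.
pose Q i w := [|| i < a (drop 2 w), i < nth 0 w 0 | nth_code (l (drop 2 w)) i == nth_code (l (drop 2 w)) (i - nth 0 w 0)].
have Hl2 := comp_drop2 Hl.
apply: (comp_all (P := Q)); first exact: comp_size.
have Ha4 := comp_drop2 (comp_drop2 Ha); have Hl4 := comp_drop2 Hl2.
have H0 : computable N.+4 (fun w => nth 0 (drop 2 w) 0) by apply: (comp_drop2 (comp_nth _ 0)).
have Hi : computable N.+4 (fun w => nth 0 w 0) by exact: comp_nth.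
apply: comp_or; first by apply: comp_leq => //; exact: comp_S.
apply: comp_or; first by apply: comp_leq => //; exact: comp_S.
apply: comp_eq; apply: comp_nth_code => //; exact: comp_sub.
Qed.

Ltac comp_arith := repeat first
  [ assumption | apply: comp_const | apply: comp_exp | apply: comp_mul | apply: comp_add
  | apply: comp_fact | apply: comp_S ].

Section Bounds.
Variables (N : nat) (f g p : seq nat -> nat).
Hypotheses (Hf : computable N f) (Hg : computable N g) (Hp : computable N p).

Lemma comp_run : computable N (fun v => b_run (f v) (g v)).
Proof. by rewrite /b_run; comp_arith. Qed.

Lemma comp_sat : computable N (fun v => b_sat (f v) (g v)).
Proof. by have H := comp_run; rewrite /b_sat; comp_arith. Qed.

Lemma comp_b_rec : computable N (fun v => b_rec (f v) (g v)).
Proof. by have H := comp_run; have H2 := comp_sat; rewrite /b_rec; comp_arith. Qed.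

Lemma comp_win : computable N (fun v => b_win (f v) (g v)).
Proof. by have H := comp_run; have H2 := comp_sat; have H3 := comp_b_rec; rewrite /b_win; comp_arith. Qed.

Lemma comp_data : computable N (fun v => b_data (f v) (g v)).
Proof. by have H := comp_win; rewrite /b_data; comp_arith. Qed.

Lemma comp_b_period : computable N (fun v => b_period (f v) (g v)).
Proof. by have H := comp_data; have H2 := comp_b_rec; rewrite /b_period /b_step; comp_arith. Qed.

Lemma comp_idem_exp : computable N (fun v => idem_exp (f v)).
Proof. by rewrite /idem_exp; comp_arith. Qed.

Lemma comp_idem_len : computable N (fun v => idem_len (f v) (g v)).
Proof. by have H := comp_idem_exp; rewrite /idem_len; comp_arith. Qed.

Lemma comp_test_bound : computable N (fun v => test_bound (f v) (g v) (p v)).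
Proof. by rewrite /test_bound; comp_arith. Qed.
End Bounds.

Lemma comp_period_bound (N : nat) (f g : seq nat -> nat) : computable N f -> computable N g -> computable N (fun v => period_bound (f v) (g v)).
Proof.
move=> Hf Hg; have H1 := comp_idem_exp Hf; have H2 := comp_idem_len Hf Hg.
by have H3 := comp_b_period Hf H2; rewrite /period_bound; comp_arith.
Qed.

(* The code [x] itself bounds the length of all words it contains. *)
Definition decide (x : nat) : nat :=
  let n := nth_code x 0 in let m := nth_code x 1 in let a := nth_code x 2 in
  let phi := nth_code x 3 in let h := nth_code x 4 in
  let P := period_bound n x in let K := test_bound n m P in
  let word k := decode (flatmap_code h (iter k (flatmap_code phi) (code_list [:: a]))) in
  has_period_after (size (word K)) P (word (K + K)).

Lemma comp_decide : computable 1 (fun v => decide (nth 0 v 0)).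
Proof.
have Hx : computable 1 (fun v => nth 0 v 0) by exact: comp_nth.
have Hc i : computable 1 (fun v => nth_code (nth 0 v 0) i) by apply: comp_nth_code => //; exact: comp_const.
have HP := comp_period_bound (Hc 0) Hx.
have HK := comp_test_bound (Hc 0) (Hc 1) HP.
have Ha : computable 1 (fun v => code_list [:: nth_code (nth 0 v 0) 2]).
  by apply: comp_S; apply: comp_pair => //; exact: comp_const.
have Hw k : computable 1 k -> computable 1 (fun v => flatmap_code (nth_code (nth 0 v 0) 4)
   (iter (k v) (flatmap_code (nth_code (nth 0 v 0) 3)) (code_list [:: nth_code (nth 0 v 0) 2]))).
  by move=> Hk; apply: comp_flatmap => //; exact: comp_iter_flatmap.
apply: comp_has_period_after => //; first by apply: comp_size; exact: Hw.
by apply: Hw; exact: comp_add.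
Qed.

Lemma tri_ge w : w <= tri w.
Proof. by elim: w => // w IH; rewrite triS; lia. Qed.

Lemma code_list_ge s x : x \in s -> x <= code_list s.
Proof.
elim: s => // y s IH; rewrite inE /= => /orP[/eqP->|/IH H]; apply: leqW.
  rewrite /cantor_pair -/(tri _); apply: leq_trans (leq_addr _ _).
  exact: leq_trans (leq_addr _ _) (tri_ge _).
by apply: leq_trans H _; rewrite /cantor_pair leq_addl.
Qed.

Lemma size_code_list s : size s <= code_list s.
Proof. by rewrite -{1}(code_listK s) size_decode. Qed.

Lemma flatmap_code_morph n k (f : 'I_n -> seq 'I_k) (s : seq 'I_n) :
  flatmap_code (encode_morph f) (encode_word s) = encode_word (morph f s).
Proof.
rewrite /flatmap_code /encode_word code_listK; congr code_list.
rewrite /morph map_flatten -!map_comp; congr flatten; apply: eq_map => i /=.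
rewrite /nth_code code_listK (nth_map i) ?size_enum_ord //.
by rewrite nth_ord_enum code_listK.
Qed.

Lemma decide_encode (n m : nat) (phi : 'I_n -> seq 'I_n) (h : 'I_n -> seq 'I_m) (a : 'I_n) :
  decide (encode_input phi h a) = verdict phi h a (encode_input phi h a).
Proof.
pose x := encode_input phi h a; rewrite -/x.
have E i : nth_code x i = nth 0 [:: n; m; val a; encode_morph phi; encode_morph h] i.
  by rewrite /nth_code code_listK.
have W k : decode (flatmap_code (encode_morph h) (iter k (flatmap_code (encode_morph phi)) (code_list [:: val a])))
  = map val (morph h (pw phi k a)).
  have -> : iter k (flatmap_code (encode_morph phi)) (code_list [:: val a]) = encode_word (pw phi k a).
    by elim: k => //= k ->; rewrite flatmap_code_morph.
  by rewrite flatmap_code_morph code_listK.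
by rewrite /decide !E !W size_map.
Qed.

Lemma size_encode_word n (s : seq 'I_n) : size s <= encode_word s.
Proof. by rewrite -(size_map val) size_code_list. Qed.

Lemma size_le_encode n k (f : 'I_n -> seq 'I_k) i : size (f i) <= encode_morph f.
Proof.
apply: leq_trans (size_encode_word (f i)) _; apply: code_list_ge.
by apply: map_f; rewrite mem_enum.
Qed.

Theorem theorem3 :
  exists prog : code,
    forall (n m : nat) (phi : 'I_n -> seq 'I_n) (h : 'I_n -> seq 'I_m) (a1 : 'I_n),
      extends_over phi a1 ->
      infinite_image h (fixpoint phi a1) ->
      exists r : nat,
        eval prog [:: encode_input phi h a1] r /\
        ((image_ultimately_periodic h (fixpoint phi a1) /\ r = 1) \/
         (~ image_ultimately_periodic h (fixpoint phi a1) /\ r = 0)).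
Proof.
have [prog Hprog] := comp_decide; exists prog => n m phi h a1 ext inf.
exists (decide (encode_input phi h a1)); split; first exact: (Hprog [:: _]).
have phi_le b : size (phi b) <= encode_input phi h a1.
  apply: leq_trans (size_le_encode phi b) (code_list_ge _).
  by rewrite !inE eqxx !orbT.
have h_le b : size (h b) <= encode_input phi h a1.
  apply: leq_trans (size_le_encode h b) (code_list_ge _).
  by rewrite !inE eqxx !orbT.
have V := verdictP ext inf phi_le h_le.
rewrite decide_encode; case: (verdict _ _ _ _) V => V; [left|right]; split=> //.
  exact/V.
by move=> /V.
Qed.
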